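(* Let $R=\mathbb{Q}[z]$. There is an isomorphism of $R$-algebras $\nabla:\mathcal{E}\to R[\mathcal{S}_0]$, where $\mathcal{E}$ is the skein algebra of virtual knots and $R[\mathcal{S}_0]$ is the polynomial algebra over $R$ generated by the set $\mathcal{S}_0$ of homotopy classes of homotopically non-trivial virtual strings.
   Context: A virtual string is an oriented circle $S$ with $2m$ distinct points partitioned into $m$ ordered pairs $(a,b)$ (arrows); $ab$ is the arc from $a$ to $b$ in the positive direction. Homotopy of strings: generated by orientation-preserving homeomorphisms carrying arrows to arrows and the moves (a) add $(a,b)$ with $ab$ free of endpoints; (b) for two disjoint endpoint-free arcs with endpoints $a,a'$ and $b,b'$ (any orders), add $(a,b),(b',a')$; (c) replace $(a^+,b),(b^+,c),(c^+,a)$, with $aa^+,bb^+,cc^+$ disjoint endpoint-free arcs, by $(a,b^+),(b,c^+),(c,a^+)$; and inverses. Homotopically trivial = homotopic to a string without arrows. An arrow diagram is a virtual string with a sign $\pm$ on each arrow. Moves on arrow diagrams: (a) add $(a,b)$ with $ab$ endpoint-free, with either sign; (b) as string move (b), the two new arrows having opposite signs; (c) replace arrows $((a^+,b),+),((b^+,c),+),((c^+,a),-)$ (arcs as in (c)) by $((a,b^+),+),((b,c^+),+),((c,a^+),-)$. A virtual knot is an equivalence class of arrow diagrams under sign-preserving homeomorphisms, these moves and inverses; $[D]$ is the class of $D$; the trivial virtual knot is the class of the diagram with no arrows. $\mathcal{K}$ is the set of virtual knots and $R[\mathcal{K}]$ the commutative polynomial algebra over $R$ on $\mathcal{K}$.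 For an arrow diagram $D$ with core $S$ and an arrow $e=(a,b)$ of sign $+$: $D^-_e$ is $D$ with the sign of $e$ changed to $-$; $D'_e$ is $D$ with all arrows having at least one endpoint on $ba$ removed; $D''_e$ is $D$ with all arrows having at least one endpoint on $ab$ removed. The skein ideal is the ideal of $R[\mathcal{K}]$ generated by the trivial virtual knot and all elements $[D]-[D^-_e]-z[D'_e][D''_e]$; $\mathcal{E}$ is the quotient of $R[\mathcal{K}]$ by the skein ideal. *)

(* Defs.v *)
From HB Require Import structures.
From mathcomp Require Import all_boot all_algebra generic_quotient.
Set Warnings "-notation-overridden,-ambiguous-paths,-notation-incompatible-prefix".
From mathcomp.multinomials Require Import monalg.
From Stdlib Require Import Relations ClassicalEpsilon.

Set Implicit Arguments.
Unset Strict Implicit.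
Unset Printing Implicit Defensive.

Import GRing.Theory.
Local Open Scope ring_scope.
Local Open Scope quotient_scope.

(* Encoding.  A virtual string / arrow diagram with m arrows is encoded by
   the word of its 2m endpoints read along the core circle in the positive
   direction, starting at an arbitrary base point of the circle which is not
   an endpoint.  An endpoint of a virtual string is a pair (i, h) where
   i : nat is the label of its arrow and h = false for the tail a of the
   arrow (a,b), h = true for its head b.  For arrow diagrams an endpoint
   additionally carries the sign of its arrow (true = +, false = -).
   The choice of the base point and of the labels is immaterial: changing
   them is realised by the "homeomorphism" steps (rotation, relabelling). *)

Definition sendpt := (nat * bool)%type.
Definition dendpt := (nat * bool * bool)%type.

Definition wf_str (w : seq sendpt) : bool :=
  uniq w && all (fun e => (e.1, ~~ e.2) \in w) w.

Definition wf_diag (w : seq dendpt) : bool :=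
  uniq [seq e.1 | e <- w] && all (fun e => (e.1.1, ~~ e.1.2, e.2) \in w) w.

Inductive sstep : seq sendpt -> seq sendpt -> Prop :=
(* orientation-preserving homeomorphisms: change of base point ... *)
| sstep_rot u v : sstep (u ++ v) (v ++ u)
(* ... and renaming of the arrows *)
| sstep_relabel (f : nat -> nat) w : injective f ->
    sstep w [seq (f e.1, e.2) | e <- w]
(* move (a): add (a,b) with ab free of endpoints *)
| sstep_a u v p : sstep (u ++ v) (u ++ (p, false) :: (p, true) :: v)
(* move (b): two disjoint endpoint-free arcs, with endpoints {a,a'} and
   {b,b'} in either order; add (a,b) and (b',a') *)
| sstep_b u v t p q (oX oY : bool) :
    let a := (p, false) in let b := (p, true) in
    let b' := (q, false) in let a' := (q, true) in
    sstep (u ++ v ++ t)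
          (u ++ (if oX then [:: a; a'] else [:: a'; a]) ++ v ++
                (if oY then [:: b; b'] else [:: b'; b]) ++ t)
(* move (c): (a+,b),(b+,c),(c+,a)  ~>  (a,b+),(b,c+),(c,a+), where the arcs
   a a+, b b+, c c+ are disjoint and endpoint-free (two cyclic orders) *)
| sstep_c1 v1 v2 v3 p1 p2 p3 :
    sstep ([:: (p3, true); (p1, false)] ++ v1 ++ [:: (p1, true); (p2, false)]
             ++ v2 ++ [:: (p2, true); (p3, false)] ++ v3)
          ([:: (p1, false); (p3, true)] ++ v1 ++ [:: (p2, false); (p1, true)]
             ++ v2 ++ [:: (p3, false); (p2, true)] ++ v3)
| sstep_c2 v1 v2 v3 p1 p2 p3 :
    sstep ([:: (p3, true); (p1, false)] ++ v1 ++ [:: (p2, true); (p3, false)]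
             ++ v2 ++ [:: (p1, true); (p2, false)] ++ v3)
          ([:: (p1, false); (p3, true)] ++ v1 ++ [:: (p3, false); (p2, true)]
             ++ v2 ++ [:: (p2, false); (p1, true)] ++ v3).

Inductive dstep : seq dendpt -> seq dendpt -> Prop :=
| dstep_rot u v : dstep (u ++ v) (v ++ u)
| dstep_relabel (f : nat -> nat) w : injective f ->
    dstep w [seq (f e.1.1, e.1.2, e.2) | e <- w]
| dstep_a u v p s : dstep (u ++ v) (u ++ (p, false, s) :: (p, true, s) :: v)
| dstep_b u v t p q (oX oY : bool) s :
    let a := (p, false, s) in let b := (p, true, s) in
    let b' := (q, false, ~~ s) in let a' := (q, true, ~~ s) in
    dstep (u ++ v ++ t)
          (u ++ (if oX then [:: a; a'] else [:: a'; a]) ++ v ++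
                (if oY then [:: b; b'] else [:: b'; b]) ++ t)
(* move (c): ((a+,b),+),((b+,c),+),((c+,a),-) ~> ((a,b+),+),((b,c+),+),((c,a+),-) *)
| dstep_c1 v1 v2 v3 p1 p2 p3 :
    dstep ([:: (p3, true, false); (p1, false, true)] ++ v1
             ++ [:: (p1, true, true); (p2, false, true)] ++ v2
             ++ [:: (p2, true, true); (p3, false, false)] ++ v3)
          ([:: (p1, false, true); (p3, true, false)] ++ v1
             ++ [:: (p2, false, true); (p1, true, true)] ++ v2
             ++ [:: (p3, false, false); (p2, true, true)] ++ v3)
| dstep_c2 v1 v2 v3 p1 p2 p3 :
    dstep ([:: (p3, true, false); (p1, false, true)] ++ v1
             ++ [:: (p2, true, true); (p3, false, false)] ++ v2
             ++ [:: (p1, true, true); (p2, false, true)] ++ v3)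
          ([:: (p1, false, true); (p3, true, false)] ++ v1
             ++ [:: (p3, false, false); (p2, true, true)] ++ v2
             ++ [:: (p2, false, true); (p1, true, true)] ++ v3).

Definition homotopic : relation (seq sendpt) :=
  clos_refl_sym_trans _ (fun w w' => [/\ wf_str w, wf_str w' & sstep w w']).

Definition diag_equiv : relation (seq dendpt) :=
  clos_refl_sym_trans _ (fun w w' => [/\ wf_diag w, wf_diag w' & dstep w w']).

Definition vstring := {w : seq sendpt | wf_str w}.
Definition adiag := {w : seq dendpt | wf_diag w}.

Definition classb (T : Type) (P : T -> T -> Prop) (x y : T) : bool :=
  if excluded_middle_informative (P x y) then true else false.

Lemma classbP (T : Type) (P : T -> T -> Prop) x y : classb P x y <-> P x y.
Proof. by rewrite /classb; case: excluded_middle_informative. Qed.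

Lemma classb_equiv (T : Type) (P : T -> T -> Prop) :
  equivalence _ P ->
  [/\ ssrbool.reflexive (classb P), ssrbool.symmetric (classb P) & ssrbool.transitive (classb P)].
Proof.
case=> Pr Pt Ps; split.
- by move=> x; apply/classbP.
- move=> x y; apply/idP/idP => /classbP H; apply/classbP; exact: Ps.
- move=> y x z /classbP H1 /classbP H2; apply/classbP; exact: Pt H2.
Qed.

Lemma equiv_crst (T : Type) (R : relation T) :
  equivalence _ (clos_refl_sym_trans _ R).
Proof.
split; [exact: rst_refl | move=> x y z; exact: rst_trans | move=> x y; exact: rst_sym].
Qed.

Definition str_rel (x y : vstring) := homotopic (val x) (val y).
Definition diag_rel (x y : adiag) := diag_equiv (val x) (val y).

Lemma str_rel_equiv : equivalence _ str_rel.
Proof.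
have [r t s] := equiv_crst (fun w w' => [/\ wf_str w, wf_str w' & sstep w w']).
split; [by move=> x; apply: r | move=> x y z; apply: t | move=> x y; apply: s].
Qed.

Lemma diag_rel_equiv : equivalence _ diag_rel.
Proof.
have [r t s] := equiv_crst (fun w w' => [/\ wf_diag w, wf_diag w' & dstep w w']).
split; [by move=> x; apply: r | move=> x y z; apply: t | move=> x y; apply: s].
Qed.

Definition str_eqrel : equiv_rel vstring :=
  let: And3 r s t := classb_equiv str_rel_equiv in EquivRel (classb str_rel) r s t.
Definition diag_eqrel : equiv_rel adiag :=
  let: And3 r s t := classb_equiv diag_rel_equiv in EquivRel (classb diag_rel) r s t.

Definition Str := {eq_quot str_eqrel}.
Definition Knot := {eq_quot diag_eqrel}.

Lemma wf_str_nil : wf_str [::]. Proof. by []. Qed.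
Lemma wf_diag_nil : wf_diag [::]. Proof. by []. Qed.

(* class of a (well-formed) word; ill-formed words are sent to the class of
   the empty word, but only well-formed words are ever used below *)
Definition str_class (w : seq sendpt) : Str :=
  \pi_Str (insubd (exist _ [::] wf_str_nil : vstring) w).
Definition knot_class (w : seq dendpt) : Knot :=
  \pi_Knot (insubd (exist _ [::] wf_diag_nil : adiag) w).

Definition trivial_string : Str := str_class [::].
Definition trivial_knot : Knot := knot_class [::].

Definition S0 := {s : Str | s != trivial_string}.

Definition R := {poly rat}.
Definition z : R := 'X.

Definition RK := {malg R[{cmonom Knot}]}.
Definition RS0 := {malg R[{cmonom S0}]}.

Definition kvar (k : Knot) : RK := << ucm k >>.

Definition dkeep (s : seq dendpt) : seq dendpt :=
  [seq e <- s | (e.1.1, ~~ e.1.2, e.2) \in s].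

(* Skein generators.  For an arrow diagram D with an arrow e=(a,b) of sign +
   labelled p, write D = u ++ a :: x ++ b :: y (tail first) or
   D = u ++ b :: x ++ a :: y (head first).  In the first case
   ab = a x b, ba = b y u a, so D'_e keeps the arrows inside x and D''_e
   those inside y ++ u; in the second case ba = b x a, ab = a y u b. *)
Definition skein_elt (u x y : seq dendpt) (p : nat) (tail_first : bool) : RK :=
  let D := if tail_first then u ++ (p, false, true) :: x ++ (p, true, true) :: y
           else u ++ (p, true, true) :: x ++ (p, false, true) :: y in
  let Dm := if tail_first then u ++ (p, false, false) :: x ++ (p, true, false) :: y
            else u ++ (p, true, false) :: x ++ (p, false, false) :: y in
  let D' := if tail_first then dkeep x else dkeep (y ++ u) in
  let D'' := if tail_first then dkeep (y ++ u) else dkeep x in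
  kvar (knot_class D) - kvar (knot_class Dm)
    - z *: (kvar (knot_class D') * kvar (knot_class D'')).

Definition skein_gen (g : RK) : Prop :=
  g = kvar trivial_knot \/
  exists u x y p (tf : bool),
    wf_diag (if tf then u ++ (p, false, true) :: x ++ (p, true, true) :: y
             else u ++ (p, true, true) :: x ++ (p, false, true) :: y)
    /\ g = skein_elt u x y p tf.

Definition skein_ideal (q : RK) : Prop :=
  exists s : seq (RK * RK),
    (forall c, c \in s -> skein_gen c.2) /\ q = \sum_(c <- s) c.1 * c.2.

(* Main.v *)
Require Import Defs.
From HB Require Import structures.
From mathcomp Require Import all_boot all_algebra generic_quotient ring_quotient finmap.
From mathcomp.multinomials Require Import monalg.
From mathcomp Require Import ring zify.
From Stdlib Require Import Relations ClassicalEpsilon.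

(* An arrow diagram is expanded over the sets of pairwise unlinked arrows to be
   smoothed.  Such a set cuts the core circle into components forming a tree,
   and its weight is the probability that independent uniform labels of the
   components satisfy, for each smoothed arrow, the inequality prescribed by its
   direction and sign (times z and a sign).  Since x < y or x > y almost surely,
   the skein relation holds; symmetry in the two sides of an arrow gives invariance under
   the choice of base point and under move (b); and the identity
   [x1, x2 < x3] = [x1 < x2 < x3] + [x2 < x1 < x3], i.e. integration by parts,
   gives invariance under move (c).  Rooting the tree at the component of the
   base point makes the weight an iterated integral of polynomials in the label
   of the root, and a move performed next to the base point only involves the
   first level of the tree.

   The state without smoothings is the underlying string and all others have
   fewer arrows, so the expansion can be inverted recursively.  The inverse,
   read in the skein algebra, does not depend on the signs by the skein relation
   and is homotopy invariant by induction on the number of arrows, the expansion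
   argument being applied with strings of lower order. *)

(** Rational coefficients enter through the weights: for a tree of smoothed arrows the probability
    is the volume of an order polytope, and such volumes have denominators.

    The obstacle is that the inverse [sigma] is defined on words by means of all-positive diagrams,
    while moves (b) and (c) on diagrams involve negative arrows, and that its invariance is only
    known in lower order at the moment when it is needed. Hence each invariance result for the state
    sum separates two hypotheses: invariance of the evaluation [g] on words shorter than a bound,
    and a single equation for the full word. For [sigma], the unknown values in top length are
    replaced by a parameter chosen to make that equation true.

    The same results are then used twice: with string classes as values of [g], to define [nabla],
    and with values in the skein algebra, to bound the kernel of [nabla]. This is why the target
    algebra is an arbitrary ring [A] with a map [iota] from the scalars. *)

Set Implicit Arguments.
Unset Strict Implicit.
Unset Printing Implicit Defensive.

Import GRing.Theory.
Local Open Scope ring_scope.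
Local Open Scope quotient_scope.

(** * Integration of polynomials *)

Section Integration.

Variables (A : comNzRingType) (iota : {rmorphism {poly rat} -> A}).
Implicit Types f g : {poly A}.

Lemma iota_natV (n : nat) : iota (n.+1%:R^-1)%:P * n.+1%:R = 1.
Proof.
rewrite -(rmorph_nat iota n.+1) -rmorphM -polyC_natr -polyCM mulVf ?rmorph1 //.
by rewrite Num.Theory.pnatr_eq0.
Qed.

Definition primitive f : {poly A} :=
  \poly_(i < (size f).+1) (iota (i%:R^-1)%:P * f`_i.-1).

Definition integral f : A := (primitive f).[1].

(* At [i = 0] the junk value [0^-1 = 0] makes the constant term vanish. *)
Lemma coef_primitive f i : (primitive f)`_i = iota (i%:R^-1)%:P * f`_i.-1.
Proof.
rewrite coef_poly ltnS; case: leqP => // lt_fi.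
by rewrite nth_default ?mulr0 //; case: i lt_fi.
Qed.

Lemma deriv_primitive f : (primitive f)^`() = f.
Proof.
apply/polyP => i; rewrite coef_deriv coef_primitive -mulrnAl /=.
by rewrite -[iota _ *+ _]mulr_natr iota_natV mul1r.
Qed.

Lemma primitive0_coef0 f : (primitive f)`_0 = 0.
Proof. by rewrite coef_primitive invr0 rmorph0 mul0r. Qed.

(** Positive integers are invertible in [A] through [iota], so the derivative loses only the
    constant term. The identities on primitives below thus reduce to derivatives. *)
Lemma deriv_coef0_inj f g : f^`() = g^`() -> f`_0 = g`_0 -> f = g.
Proof.
move=> dfg fg0; apply/polyP => -[|i] //.
have cancel_deriv (p : {poly A}) : p`_i.+1 = iota (i.+1%:R^-1)%:P * p^`()`_i.
  by rewrite coef_deriv mulrnAr -mulrnAl -[iota _ *+ _]mulr_natr iota_natV mul1r.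
by rewrite !cancel_deriv dfg.
Qed.

Lemma primitive_is_linear : linear primitive.
Proof.
move=> a f g; apply: deriv_coef0_inj.
  by rewrite derivD derivZ !deriv_primitive.
by rewrite coefD coefZ !primitive0_coef0 mulr0 addr0.
Qed.
HB.instance Definition _ := GRing.isLinear.Build A {poly A} {poly A} _ primitive
  primitive_is_linear.

Lemma integral_is_scalar : scalar integral.
Proof. by move=> a f g; rewrite /integral linearP hornerD hornerZ. Qed.
HB.instance Definition _ := GRing.isLinear.Build A {poly A} A _ integral
  integral_is_scalar.

Lemma primitiveC a : primitive a%:P = a *: 'X.
Proof.
apply: deriv_coef0_inj; rewrite ?deriv_primitive ?derivZ ?derivX ?alg_polyC //.
by rewrite primitive0_coef0 coefZ coefX mulr0.
Qed.

Lemma integralC a : integral a%:P = a.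
Proof. by rewrite /integral primitiveC hornerZ hornerX mulr1. Qed.

(* Integration by parts: [primitive] is a Rota-Baxter operator of weight 0. *)
Lemma primitiveM f g :
  primitive f * primitive g = primitive (primitive f * g) + primitive (f * primitive g).
Proof.
apply: deriv_coef0_inj.
  by rewrite derivM derivD !deriv_primitive addrC.
by rewrite coefD coef0M !primitive0_coef0 mul0r addr0.
Qed.

Lemma integralM f g :
  integral f * integral g = integral (primitive f * g) + integral (f * primitive g).
Proof. by rewrite /integral -hornerM primitiveM hornerD. Qed.

(* The random-label weight of a smoothed arrow: a component is given a uniform
   label in [0, 1], and a positive (negative) arrow contributes the indicator
   that its [ab]-side has the smaller label (minus the indicator that it has
   the larger one).  [f] is a function of the label of the component split off
   by an arrow whose first endpoint is a head iff [h], and the result is a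
   function of the label of the other component. *)
Definition weight (h s : bool) f : {poly A} :=
  (-1) ^+ h *: (primitive f - (if h == s then integral f else 0)%:P).

Lemma weight_is_linear h s : linear (weight h s).
Proof.
move=> a f g; rewrite /weight !linearP /=; case: (h == s); last first.
  by rewrite !subr0 scalerDr !scalerA mulrC.
by rewrite polyCD polyCM -!mul_polyC; ring.
Qed.
HB.instance Definition _ h s := GRing.isLinear.Build A {poly A} {poly A} _ (weight h s)
  (weight_is_linear h s).

(** Reading the arrow from its other end and changing its sign each reverse the prescribed
    inequality; together they restore it, and only the minus sign of a negative arrow remains. This
    cancels the two arrows of move (b). *)
Lemma weightN h s f : weight (~~ h) (~~ s) f = - weight h s f.
Proof. by rewrite /weight; case: h; case: s; rewrite /= -!mul_polyC; ring. Qed.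

(** The two indicators are complementary up to measure zero, so they add up to 1 and the label of
    the root becomes unconstrained. *)
Lemma weight_skein h f : weight h true f - weight h false f = (integral f)%:P.
Proof. by rewrite /weight; case: h; rewrite /= -!mul_polyC; ring. Qed.

(** Both sides are one double integral over the labels on the two sides of an arrow; they differ in
    which side is the root. This is what moving the base point across a smoothed arrow requires. *)
Lemma weight_adjoint h s f g :
  integral (weight h s f * g) = integral (f * weight (~~ h) s g).
Proof.
have IC a u : integral (u * a%:P) = a * integral u by rewrite mulrC mul_polyC linearZ.
have parts := integralM f g.
by rewrite /weight; case: h; case: s => /=;
  rewrite ?(expr1, expr0, scaleN1r, scale1r, polyC0, subr0) ?(mulNr, mulrN, mulrBl, mulrBr)
    ?(linearN, linearB) /= ?[_%:P * g]mulrC !IC ?[integral g * _]mulrC parts; ring.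
Qed.

(** With [P] the primitive, [t = false] reads [P f * P g = P (P f * g) + P (P g * f)]: two labels
    below a third are ordered in one of two ways. For [t = true], [P g] is replaced by
    [integral g - P g] and the extra terms cancel. The three terms come from the states of move (c)
    with two smoothed arrows. *)
Lemma weight_triangle t f g :
  weight (~~ t) t (weight t (~~ t) f * g + weight t true g * f)
    + weight t (~~ t) f * weight t true g = 0.
Proof.
have JC a u : primitive (a%:P * u) = a%:P * primitive u by rewrite !mul_polyC linearZ.
have JD u v : primitive (u + v) = primitive u + primitive v by exact: linearD.
have JN u : primitive (- u) = - primitive u by exact: linearN.
have parts : primitive f * primitive g = primitive (primitive f * g) + primitive (primitive g * f).
  by rewrite primitiveM [f * _]mulrC.
rewrite /weight; case: t => /=;
  rewrite ?(expr1, expr0, scaleN1r, scale1r, polyC0, subr0) ?(mulNr, mulrN, mulrBl) ?mulrBr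
   !(JD, JN, JC) parts; ring.
Qed.

End Integration.

(** * The state sum *)

Definition bar (e : dendpt) : dendpt := (e.1.1, ~~ e.1.2, e.2).

Lemma barK : involutive bar.
Proof. by move=> [[p h] s]; rewrite /bar /= negbK. Qed.

Lemma bar_neq e : bar e != e.
Proof. by case: e => -[p h] s; rewrite !xpair_eqE; case: h; rewrite andbF. Qed.

Lemma split_first (T : eqType) (c : T) w : c \in w ->
  exists x y, w = x ++ c :: y /\ c \notin x.
Proof.
move=> cw; exists (take (index c w) w), (drop (index c w).+1 w); split.
  by rewrite -[RHS]cats0 -{1}(cat_take_drop (index c w) w) cats0 (drop_nth c) ?index_mem // nth_index.
by rewrite in_take_leq ?index_size // ltnn.
Qed.

(** Mirrors the recursion of the state sum: besides the tail, the two pieces cut out by smoothing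
    the first arrow are available to the induction. *)
Lemma word_ind (Q : seq dendpt -> Prop) :
  Q [::] ->
  (forall c w, bar c \notin w -> Q w -> Q (c :: w)) ->
  (forall c x y, bar c \notin x -> Q x -> Q y -> Q (x ++ bar c :: y) ->
     Q (c :: x ++ bar c :: y)) ->
  forall w, Q w.
Proof.
move=> Q0 Qsolo Qpair w; have [n] := ubnP (size w); elim: n w => // n IH [//|c w] /=.
rewrite ltnS => sw; have [/split_first [x] [y] [Dw cx]|/Qsolo] := boolP (bar c \in w); last first.
  by apply; apply: IH.
by move: sw; rewrite Dw size_cat /= => sw; apply: Qpair => //; apply: IH;
  rewrite ?size_cat /=; lia.
Qed.

Section StateSum.

Variables (A : comNzRingType) (iota : {rmorphism {poly rat} -> A}) (g : seq sendpt -> A).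
Implicit Types (h : seq dendpt -> A) (c e : dendpt) (v w x y : seq dendpt).

Local Notation zeta := (iota 'X).

Definition weight_of c : {poly A} -> {poly A} := weight iota c.1.2 c.2.

(* Endpoints whose partner lies on another component are dropped. *)
Definition component w : A := g [seq e.1 | e <- dkeep w].

(** [h] is a continuation collecting the letters kept on the root component. Smoothing the arrow of
    [c] splits off the part up to [bar c], and the two parts are expanded independently: an arrow
    joining them is linked with [c], hence no longer available for smoothing, and [component] drops
    its ends. [n] is fuel. *)
Fixpoint state_sum_rec n h w : {poly A} :=
  match n, w with
  | n'.+1, c :: w' =>
      state_sum_rec n' (fun r => h (c :: r)) w' +
      (if bar c \in w' then
         zeta *: (weight_of c (state_sum_rec n' component (take (index (bar c) w') w'))
                  * state_sum_rec n' h (drop (index (bar c) w').+1 w'))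
       else 0)
  | _, _ => (h [::])%:P
  end.

(* Sum over the ways to smooth pairwise unlinked arrows of [w], as a function
   of the label of the component through the base point; [h] evaluates the
   word of that component. *)
Definition state_sum h w := state_sum_rec (size w) h w.
Definition rooted w := state_sum component w.
Definition closed_sum w : A := integral iota (rooted w).

Lemma state_sum_rec_fuel n h w : (size w <= n)%N ->
  state_sum_rec n h w = state_sum h w.
Proof.
rewrite /state_sum; have: (size w <= size w)%N by [].
move: {2 4}(size w) => m; elim: n m h w => [|n IH] [|m] h [|c w] //=; rewrite !ltnS => lem len.
by rewrite (IH m) //; case: ifP => // cw; congr (_ + _ *: (weight_of _ _ * _));
  apply: IH; rewrite ?size_take_min ?size_drop; lia.
Qed.

Lemma state_sum_nil h : state_sum h [::] = (h [::])%:P.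
Proof. by []. Qed.

Lemma state_sum_solo h c w : bar c \notin w ->
  state_sum h (c :: w) = state_sum (fun r => h (c :: r)) w.
Proof. by rewrite {1}/state_sum /= => /negPf->; rewrite addr0. Qed.

Lemma state_sum_pair h c x y : bar c \notin x ->
  state_sum h (c :: x ++ bar c :: y) = state_sum (fun r => h (c :: r)) (x ++ bar c :: y)
    + zeta *: (weight_of c (rooted x) * state_sum h y).
Proof.
move=> cx; rewrite {1}/state_sum /= mem_cat inE eqxx orbT index_cat (negPf cx) /= eqxx addn0.
rewrite take_size_cat // -cat_rcons drop_size_cat ?size_rcons // cat_rcons.
by rewrite !state_sum_rec_fuel // size_cat /=; lia.
Qed.

Lemma eq_state_sum h h' w : (forall r, subseq r w -> h r = h' r) ->
  state_sum h w = state_sum h' w.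
Proof.
elim/word_ind: w h h' => [|c w cw IH|c x y cx _ IHy IH] h h' eqh.
- by rewrite !state_sum_nil eqh.
- by rewrite !state_sum_solo //; apply: IH => r rw; apply: eqh; rewrite /= eqxx.
- rewrite !state_sum_pair //; congr (_ + _ *: (_ * _)).
    by apply: IH => r rw; apply: eqh; rewrite /= eqxx.
  apply: IHy => r ry; apply: eqh; apply: subseq_trans ry _.
  by rewrite -cat_cons -cat_rcons suffix_subseq.
Qed.

Lemma component_filter (T : pred dendpt) w :
  {in w, forall e, ~~ T e -> bar e \notin w} -> component (filter T w) = component w.
Proof.
move=> lone; congr (g _); congr map; rewrite /dkeep -filter_predI.
apply: eq_in_filter => e ew /=; rewrite -/(bar e) mem_filter.
case: (boolP (bar e \in w)) => [bw|]; last by rewrite andbF.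
have -> : T e by apply/negPn/negP => /(lone e ew); rewrite bw.
by rewrite !andbT; apply/negPn/negP => /(lone _ bw); rewrite barK ew.
Qed.

(** A letter without partner is never smoothed, and [component] ignores it in every split-off piece,
    so it can be removed in advance if [h] ignores it too. *)
Lemma state_sum_filter (T : pred dendpt) h h' w :
  {in w, forall e, ~~ T e -> bar e \notin w} ->
  (forall r, subseq r w -> h r = h' (filter T r)) ->
  state_sum h w = state_sum h' (filter T w).
Proof.
elim/word_ind: w h h' => [|c w cw IH|c x y cx IHx IHy IH] h h' lone eqh.
- by rewrite !state_sum_nil eqh.
- have lone' : {in w, forall e, ~~ T e -> bar e \notin w}.
    move=> e ew Te; have := lone e _ Te; rewrite !inE ew orbT => /(_ isT).
    by rewrite negb_or => /andP[].
  rewrite state_sum_solo //=; case: ifP => Tc; last first.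
    by apply: IH => // r rw; rewrite eqh /= ?Tc ?eqxx.
  rewrite state_sum_solo ?mem_filter ?negb_and ?cw ?orbT //.
  by apply: IH => // r rw; rewrite eqh /= ?Tc ?eqxx.
- have Tc : T c.
    apply/negPn/negP => /(lone c (mem_head _ _)).
    by rewrite !inE mem_cat !inE eqxx !orbT.
  have Tbc : T (bar c).
    apply/negPn/negP => /(lone (bar c)).
    by rewrite barK mem_head inE mem_cat inE eqxx !orbT => /(_ isT).
  have lone' w' : {subset w' <= c :: x ++ bar c :: y} ->
      {in w', forall e, ~~ T e -> bar e \notin w'}.
    by move=> sw e ew Te; apply: contra (lone e (sw _ ew) Te); apply: sw.
  have [sx sy] : {subset x <= c :: x ++ bar c :: y} /\ {subset y <= c :: x ++ bar c :: y}.
    by split=> e ee; rewrite !inE mem_cat inE ee !orbT.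
  rewrite /= Tc filter_cat /= Tbc !state_sum_pair ?mem_filter ?negb_and ?cx ?orbT //.
  congr (_ + _ *: (weight_of _ _ * _)).
  + rewrite (IH _ (fun r => h' (c :: r))) ?filter_cat /= ?Tbc //.
      by apply: lone' => e ee; rewrite inE ee orbT.
    by move=> r rw; rewrite eqh /= ?Tc ?eqxx.
  + apply: IHx; first exact: lone'.
    move=> r rx; rewrite component_filter //; apply: lone' => e er.
    exact: sx (mem_subseq rx er).
  + apply: IHy; first exact: lone'.
    move=> r ry; apply: eqh; apply: subseq_trans ry _.
    by rewrite -cat_cons -cat_rcons suffix_subseq.
Qed.

Lemma rooted_filter (T : pred dendpt) w :
  {in w, forall e, ~~ T e -> bar e \notin w} -> rooted (filter T w) = rooted w.
Proof.
move=> lone; apply/esym/state_sum_filter => // r rw; rewrite component_filter //.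
by move=> e er Te; apply: contra (lone e (mem_subseq rw er) Te); apply: mem_subseq.
Qed.

(* Either an arrow starting in [v] jumps over the beginning of the tail, or all
   of the beginning of the tail is read by the root component. *)
Lemma state_sum_site v t t' h h' h'' f :
  (forall v1 c v2, v = v1 ++ c :: v2 -> bar c \notin v2 ->
     (bar c \notin t /\ bar c \notin t') \/
     exists t1 t2 t1' t2',
       [/\ t = t1 ++ bar c :: t2 /\ t' = t1' ++ bar c :: t2',
           bar c \notin t1, bar c \notin t1',
           rooted (v2 ++ t1) = rooted (v2 ++ t1')
         & forall r, subseq r v1 ->
             state_sum (fun s => h (r ++ s)) t2 = state_sum (fun s => h' (r ++ s)) t2']) ->
  (forall r, subseq r v ->
     state_sum (fun s => h (r ++ s)) t = state_sum (fun s => h' (r ++ s)) t' + h'' r *: f) ->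
  state_sum h (v ++ t) = state_sum h' (v ++ t') + state_sum h'' v * f.
Proof.
elim/word_ind: v h h' h'' => [|c v cv IH|c x y cx _ IHy IH] h h' h'' jump root.
- by rewrite state_sum_nil mul_polyC (root [::]).
- have IHc : state_sum (fun s => h (c :: s)) (v ++ t) =
      state_sum (fun s => h' (c :: s)) (v ++ t') + state_sum (fun s => h'' (c :: s)) v * f.
    apply: IH => [v1 d v2 Dv dv2|r rv]; last by apply: (root (c :: r)); rewrite /= eqxx.
    have [|] := jump (c :: v1) d v2 (congr1 (cons c) Dv) dv2; first by left.
    case=> t1 [t2] [t1'] [t2'] [Dt dt1 dt1' eqG eqS]; right; exists t1, t2, t1', t2'; split=> //.
    by move=> r rv1; apply: (eqS (c :: r)); rewrite /= eqxx.
  rewrite (state_sum_solo _ cv).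
  have [[ct ct']|] := jump [::] c v erefl cv.
    by rewrite !cat_cons !state_sum_solo ?mem_cat ?negb_or ?cv.
  case=> t1 [t2] [t1'] [t2'] [[Dt Dt'] ct1 ct1' eqG /(_ [::] isT) eqS].
  rewrite Dt Dt' !catA !cat_cons !state_sum_pair ?mem_cat ?negb_or ?cv //.
  rewrite -!catA -Dt -Dt' IHc eqG.
  have -> : state_sum h t2 = state_sum h' t2' := eqS.
  by rewrite addrAC.
- rewrite (state_sum_pair _ _ cx) !cat_cons -!catA !cat_cons !state_sum_pair //.
  rewrite (IHy h h' h''); first 1 last.
  + move=> v1 d v2 Dv dv2.
    have Dv' : c :: x ++ bar c :: y = (c :: x ++ bar c :: v1) ++ d :: v2 by rewrite Dv /= -catA.
    have [|] := jump _ _ _ Dv' dv2; last first.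
      case=> t1 [t2] [t1'] [t2'] [Dt dt1 dt1' eqG eqS]; right; exists t1, t2, t1', t2'; split=> //.
      move=> r rv1; apply: eqS; apply: subseq_trans rv1 _.
      by rewrite -cat_cons -cat_rcons suffix_subseq.
    by left.
  + move=> r ry; apply: root; apply: subseq_trans ry _.
    by rewrite -cat_cons -cat_rcons suffix_subseq.
  have IHc : state_sum (fun s => h (c :: s)) ((x ++ bar c :: y) ++ t) =
      state_sum (fun s => h' (c :: s)) ((x ++ bar c :: y) ++ t')
      + state_sum (fun s => h'' (c :: s)) (x ++ bar c :: y) * f.
    apply: IH => [v1 d v2 Dv dv2|r rv]; last by apply: (root (c :: r)); rewrite /= eqxx.
    have [|] := jump (c :: v1) d v2 (congr1 (cons c) Dv) dv2; first by left.
    case=> t1 [t2] [t1'] [t2'] [Dt dt1 dt1' eqG eqS]; right; exists t1, t2, t1', t2'; split=> //.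
    by move=> r rv1; apply: (eqS (c :: r)); rewrite /= eqxx.
  move: IHc; rewrite -!catA !cat_cons => ->.
  by rewrite -!mul_polyC; ring.
Qed.

End StateSum.

Lemma bar_eq e e' : (bar e == bar e') = (e == e').
Proof. exact: (can_eq barK). Qed.

Lemma bar_eqF e : ((bar e == e) = false) * ((e == bar e) = false).
Proof. by rewrite [e == _]eq_sym (negPf (bar_neq e)). Qed.

Lemma label_neq (e e' : dendpt) : e.1.1 != e'.1.1 ->
  ((e == e') = false) * ((e' == e) = false) * ((e == bar e') = false) *
  ((bar e == e') = false) * ((e' == bar e) = false) * ((bar e' == e) = false).
Proof.
case: e e' => [[p h] s] [[p' h'] s'] /= /negPf np.
by rewrite /bar !xpair_eqE /= [p' == p]eq_sym np.
Qed.

Definition avoids (L : seq nat) (w : seq dendpt) := all (fun e => e.1.1 \notin L) w.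

Lemma avoids_cat L v w : avoids L (v ++ w) = avoids L v && avoids L w.
Proof. exact: all_cat. Qed.

Lemma avoids_subseq L v w : subseq v w -> avoids L w -> avoids L v.
Proof. by move=> /mem_subseq vw /allP aw; apply/allP => e /vw /aw. Qed.

Lemma notin_avoids L w e : avoids L w -> e.1.1 \in L ->
  ((e \in w) = false) * ((bar e \in w) = false).
Proof.
by move=> /allP aw eL; split; apply: negbTE; apply: contraL eL => /aw.
Qed.

Lemma filter_avoids (l w : seq dendpt) : avoids [seq e.1.1 | e <- l] w ->
  [seq e <- w | e \notin l] = w.
Proof.
move=> /allP aw; apply/all_filterP/allP => e /aw; apply: contra; exact: map_f.
Qed.

(** * Change of base point, isolated arrows and the skein relation *)

Section Moves.

Variables (A : comNzRingType) (iota : {rmorphism {poly rat} -> A}) (g : seq sendpt -> A).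
Implicit Types (h : seq dendpt -> A) (c e : dendpt) (v w x y : seq dendpt).

Local Notation zeta := (iota 'X).
Local Notation ssum := (state_sum iota g).
Local Notation cval := (component g).
Local Notation rsum := (rooted iota g).
Local Notation csum := (closed_sum iota g).
Local Notation K := (weight_of iota).
Local Notation I := (integral iota).

Lemma rooted_nil : g [::] = 0 -> rsum [::] = 0.
Proof. by move=> g0; rewrite /rooted state_sum_nil /component /= g0. Qed.

Lemma component_drop (l w w' : seq dendpt) : all (fun e => bar e \notin w) l ->
  [seq e <- w | e \notin l] = w' -> cval w = cval w'.
Proof.
move=> /allP lone <-; apply/esym/component_filter => e _.
by rewrite negbK; apply: lone.
Qed.

Lemma rooted_drop (l w w' : seq dendpt) : all (fun e => bar e \notin w) l ->
  [seq e <- w | e \notin l] = w' -> rsum w = rsum w'.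
Proof.
move=> /allP lone <-; apply/esym/rooted_filter => e _.
by rewrite negbK; apply: lone.
Qed.

Lemma state_sum_solos h s t : all (fun e => bar e \notin s ++ t) s ->
  ssum h (s ++ t) = ssum (fun r => h (s ++ r)) t.
Proof.
elim: s h => //= c s IH h /andP[]; rewrite inE negb_or => /andP[_ cs] lone.
rewrite state_sum_solo // IH //; apply: sub_all lone => e.
by rewrite inE negb_or => /andP[].
Qed.

Lemma state_sum_last h w c : bar c \notin w ->
  ssum h (w ++ [:: c]) = ssum (fun r => h (r ++ [:: c])) w.
Proof.
move=> cw; rewrite -[w in RHS]cats0.
rewrite (@state_sum_site _ _ _ _ _ [::] _ (fun r => h (r ++ [:: c])) (fun=> 0) 0).
- by rewrite mulr0 addr0.
- move=> v1 d v2 Dw _; left; rewrite inE; split=> //.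
  by apply: contra cw => /eqP <-; rewrite barK Dw mem_cat mem_head orbT.
- by move=> r _; rewrite scaler0 addr0 state_sum_solo // !state_sum_nil cats0.
Qed.

Lemma state_sum_last_pair h x c y :
  c \notin x -> c \notin y -> bar c \notin x -> bar c \notin y ->
  ssum h (x ++ bar c :: y ++ [:: c]) =
    ssum (fun r => h (r ++ [:: c])) (x ++ bar c :: y)
    + zeta *: (K (bar c) (rsum y) * ssum h x).
Proof.
move=> cx cy bcx bcy.
rewrite (@state_sum_site _ _ _ x _ (bar c :: y) _ (fun r => h (r ++ [:: c])) h
   (zeta *: K (bar c) (rsum y))).
- by rewrite -scalerAr [X in _ *: X]mulrC.
- move=> v1 d v2 Dx _.
  have dx : d \in x by rewrite Dx mem_cat mem_head orbT.
  have [dc dbc] : bar d != c /\ bar d != bar c.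
    split; last by rewrite bar_eq; apply: contraNneq cx => <-.
    by apply: contraNneq bcx => <-; rewrite barK.
  have [/split_first [y1] [y2] [Dy dy1]|dy] := boolP (bar d \in y); [right | left].
    exists (bar c :: y1), (y2 ++ [:: c]), (bar c :: y1), y2.
    rewrite Dy /= -catA !inE (negPf dbc) dy1; split=> // r _.
    rewrite state_sum_last; last by apply: contra bcy; rewrite Dy mem_cat inE => ->; rewrite !orbT.
    by apply: eq_state_sum => s _; rewrite catA.
  by rewrite !inE mem_cat inE (negPf dc) (negPf dbc) (negPf dy).
- move=> r _; rewrite -{2}(barK c) state_sum_pair ?barK // state_sum_last //.
  rewrite state_sum_nil cats0 mulrC mul_polyC scalerA mulrC -scalerA; congr (_ + _).
  by rewrite state_sum_solo ?barK //; apply: eq_state_sum => s _; rewrite -catA.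
Qed.

(** If the arrow of [c] is smoothed, moving the base point across [c] exchanges the root: [x] hangs
    on [y] before, [y] on [x] afterwards, and [weight_adjoint] compares the integrals. If it is
    kept, only the root word is rotated. *)
Lemma closed_sum_rot_component c w : uniq (c :: w) ->
  (forall r, subseq r w -> cval (c :: r) = cval (r ++ [:: c])) ->
  csum (c :: w) = csum (w ++ [:: c]).
Proof.
move=> /= /andP[cw uw] eqC; rewrite /closed_sum /rooted.
have [/split_first [x] [y] [Dw bcx]|bcw] := boolP (bar c \in w); last first.
  by rewrite state_sum_solo // state_sum_last //; congr I; apply: eq_state_sum.
move: cw uw; rewrite Dw mem_cat inE !negb_or cat_uniq /= => /and3P[cx _ cy] /and3P[_ _ /andP[bcy _]].
rewrite -catA /= state_sum_last_pair // state_sum_pair // !linearD !linearZ /=.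
congr (_ + _ * _); first by congr I; apply: eq_state_sum => r rw; apply: eqC; rewrite Dw.
by rewrite /weight_of weight_adjoint mulrC.
Qed.

(** Smoothing an isolated arrow splits off an empty component, on which [g] vanishes. *)
Lemma rooted_isolated c v : g [::] = 0 -> c \notin v ->
  (forall r, subseq r v -> cval (c :: bar c :: r) = cval r) ->
  rsum (c :: bar c :: v) = rsum v.
Proof.
move=> g0 cv eqC; rewrite {1}/rooted (@state_sum_pair _ _ _ _ c [::]) //.
rewrite rooted_nil // /weight_of linear0 mul0r scaler0 addr0 state_sum_solo ?barK //.
exact: eq_state_sum.
Qed.

Lemma rooted_remove L v s t :
  avoids L v -> avoids L t -> all (fun e => e.1.1 \in L) s ->
  all (fun e => bar e \notin s) s -> rsum (v ++ s ++ t) = rsum (v ++ t).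
Proof.
move=> av at_ /allP sL /allP ss.
have out w : avoids L w -> [seq e <- w | e \notin s] = w.
  move=> aw; apply/all_filterP/allP => e ew; apply: contraL ew => es.
  by rewrite (notin_avoids aw) // sL.
apply: (@rooted_drop s).
  apply/allP => e es; have eL := sL _ es.
  by rewrite !mem_cat (notin_avoids av) // (notin_avoids at_) // (negPf (ss _ es)).
rewrite !filter_cat (out _ av) (out _ at_) (eq_in_filter (a2 := pred0)) ?filter_pred0 //.
by move=> e ->.
Qed.

(* The endpoints [s] and [s'] have their partners before [v]. *)
Lemma state_sum_replace L v s s' t h h' :
  avoids L v -> avoids L t ->
  all (fun e => e.1.1 \in L) s -> all (fun e => bar e \notin s) s ->
  all (fun e => e.1.1 \in L) s' -> all (fun e => bar e \notin s') s' ->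
  (forall r r', subseq r v -> subseq r' t -> h (r ++ s ++ r') = h' (r ++ s' ++ r')) ->
  (forall r r', subseq r v -> subseq r' t -> h (r ++ r') = h' (r ++ r')) ->
  ssum h (v ++ s ++ t) = ssum h' (v ++ s' ++ t).
Proof.
move=> av at_ sL ss sL' ss' eqs eqh.
have offs w u e : avoids L w -> all (fun e => e.1.1 \in L) u -> e \in u -> bar e \notin w.
  by move=> aw /allP uL /uL eL; rewrite (notin_avoids aw).
have offs' w u e : avoids L w -> all (fun e => e.1.1 \in L) u -> e \in w -> bar e \notin u.
  by move=> aw uL ew; apply/negP => /(offs _ _ _ aw uL); rewrite barK ew.
rewrite (@state_sum_site _ _ _ v _ (s' ++ t) _ h' (fun=> 0) 0).
- by rewrite mulr0 addr0.
- move=> v1 c v2 Dv cv2.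
  have cv : c \in v by rewrite Dv mem_cat mem_head orbT.
  have [cs cs'] : bar c \notin s /\ bar c \notin s' by split; apply: (offs' v).
  have [/split_first [t1] [t2] [Dt ct1]|ct] := boolP (bar c \in t); [right | left].
    exists (s ++ t1), t2, (s' ++ t1), t2; rewrite Dt -!catA !mem_cat !negb_or cs cs' ct1; split=> //.
      move: av at_; rewrite Dv Dt !avoids_cat /= => /and3P[_ _ av2] /andP[at1 _].
      by rewrite !(@rooted_remove L).
    move=> r rv1; apply: eq_state_sum => r' rt2; apply: eqh.
      by rewrite Dv; apply: subseq_trans rv1 (prefix_subseq _ _).
    by rewrite Dt -cat_rcons; apply: subseq_trans rt2 (suffix_subseq _ _).
  by rewrite !mem_cat !negb_or cs cs'.
- move=> r rv; rewrite scaler0 addr0 !state_sum_solos.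
  + by apply: eq_state_sum => r' rt; apply: eqs.
  + by apply/allP => e es; rewrite mem_cat negb_or (offs t s') // (allP ss').
  + by apply/allP => e es; rewrite mem_cat negb_or (offs t s) // (allP ss).
Qed.

Definition kept w v := [seq e <- v | bar e \in w].

(** The letters of the sites are paired among themselves, so they survive and do not influence which
    other letters do. The words before and after a move are therefore filtered to an instance of the
    same move. *)
Lemma dkeep_sites L s0 r1 s1 r2 s2 r3 :
  avoids L (r1 ++ r2 ++ r3) -> all (fun e => e.1.1 \in L) (s0 ++ s1 ++ s2) ->
  all (fun e => bar e \in s0 ++ s1 ++ s2) (s0 ++ s1 ++ s2) ->
  let k := kept (r1 ++ r2 ++ r3) in
  dkeep (s0 ++ r1 ++ s1 ++ r2 ++ s2 ++ r3) = s0 ++ k r1 ++ s1 ++ k r2 ++ s2 ++ k r3.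
Proof.
move=> av /allP sL /allP ss k; rewrite /dkeep; set w := s0 ++ _.
have ks s : {subset s <= s0 ++ s1 ++ s2} ->
    [seq e <- s | (e.1.1, ~~ e.1.2, e.2) \in w] = s.
  move=> sub; apply/all_filterP/allP => e /sub /ss.
  by rewrite !mem_cat => /or3P[] ->; rewrite ?orbT.
have kr r : {subset r <= r1 ++ r2 ++ r3} ->
    [seq e <- r | (e.1.1, ~~ e.1.2, e.2) \in w] = k r.
  move=> sub; apply: eq_in_filter => e /sub er.
  have : bar e \notin s0 ++ s1 ++ s2.
    by apply/negP => /sL eL; move: er; rewrite (notin_avoids (e := e) av eL).
  rewrite !mem_cat !negb_or -/(bar e) => /and3P[/negPf-> /negPf-> /negPf->].
  by [].
rewrite !filter_cat -/w !(ks s0, ks s1, ks s2, kr r1, kr r2, kr r3) // => e;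
  by rewrite !mem_cat => ->; rewrite ?orbT.
Qed.

(** States keeping the arrow do not see its sign and cancel. In the others [weight_skein] leaves a
    constant, so the labels on the two sides are independent and the integral factors. *)
Lemma closed_sum_skein (p : nat) (b : bool) x y : avoids [:: p] x -> avoids [:: p] y ->
  csum ((p, b, true) :: x ++ (p, ~~ b, true) :: y) -
  csum ((p, b, false) :: x ++ (p, ~~ b, false) :: y) =
    zeta * (csum x * csum y).
Proof.
move=> ax ay; have np s w : avoids [:: p] w -> (p, ~~ b, s) \notin w.
  by move=> aw; rewrite (notin_avoids aw) ?mem_head.
rewrite /closed_sum /rooted.
rewrite !(@state_sum_pair _ _ _ _ (p, b, _)) ?np // !linearD !linearZ /=.
set S1 := integral _ _; set S2 := integral _ (ssum _ (_ ++ (_, false) :: _)).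
have -> : S1 = S2.
  congr I; apply: (@state_sum_replace [:: p] _ [:: _] [:: _]) => //=;
    rewrite ?mem_head ?inE ?bar_eqF //.
  - move=> r r' rx ry; have ar : avoids [:: p] (r ++ r' ++ [::]).
      by rewrite !avoids_cat (avoids_subseq rx) // (avoids_subseq ry).
    rewrite /component -[r']cats0.
    have sites s := @dkeep_sites [:: p] [:: (p, b, s)] r [:: (p, ~~ b, s)] r' [::] [::] ar.
    rewrite !(sites _ _ _) /= ?mem_head ?inE /bar /= ?negbK ?eqxx ?orbT //.
    by rewrite !map_cat /= !map_cat.
  - move=> r r' rx ry; have ar : avoids [:: p] (r ++ r').
      by rewrite !avoids_cat (avoids_subseq rx) // (avoids_subseq ry).
    have drop s : cval ((p, b, s) :: r ++ r') = cval (r ++ r').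
      apply: (@component_drop [:: (p, b, s)]) => /=.
        by rewrite inE bar_eqF (notin_avoids ar) ?mem_head.
      by rewrite mem_head filter_avoids.
    by rewrite !drop.
rewrite opprD addrACA subrr add0r -mulrBr; congr (_ * _).
by rewrite -linearB -mulrBl weight_skein mul_polyC linearZ.
Qed.

End Moves.

(** * Invariance under the based moves *)

Section Reidemeister.

Variables (A : comNzRingType) (iota : {rmorphism {poly rat} -> A}) (g : seq sendpt -> A).
Hypothesis g0 : g [::] = 0.

Local Notation zeta := (iota 'X).
Local Notation ssum := (state_sum iota g).
Local Notation cval := (component g).
Local Notation rsum := (rooted iota g).
Local Notation csum := (closed_sum iota g).
Local Notation K := (weight_of iota).

(** States keeping both arrows reduce to [v ++ t] by the move on strings; states smoothing exactly
    one of them cancel in pairs, their weights being opposite. *)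
Lemma rooted_bigon c d v t (o : bool) :
  let s := if o then [:: bar c; bar d] else [:: bar d; bar c] in
  c.1.1 != d.1.1 -> (forall f, K d f = - K c f) ->
  avoids [:: c.1.1; d.1.1] v -> avoids [:: c.1.1; d.1.1] t ->
  (forall r r', subseq r v -> subseq r' t ->
     cval (c :: d :: r ++ s ++ r') = cval (r ++ r')) ->
  (forall r, subseq r v -> cval (d :: r ++ [:: bar d]) = cval r) ->
  (forall r, subseq r t -> cval (c :: bar c :: r) = cval r) ->
  rsum (c :: d :: v ++ s ++ t) = rsum (v ++ t).
Proof.
move=> s /label_neq N Kdc av at_ Hs Hd Hc.
have nin w : avoids [:: c.1.1; d.1.1] w ->
    (c \in w = false) * (d \in w = false) * (bar c \in w = false) * (bar d \in w = false).
  by move=> aw; rewrite !(notin_avoids aw) ?inE ?eqxx ?orbT.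
have drop l w w' : avoids [:: c.1.1; d.1.1] w -> l ++ w = w' -> {subset l <= [:: c; d]} ->
  cval w' = cval w.
  move=> aw <- sl; apply: (@component_drop _ _ l).
    apply/allP => e el; have := sl _ el; rewrite !inE mem_cat.
    case/orP => /eqP ->; rewrite (nin w) // orbF; apply/negP => /sl; rewrite !inE ?bar_eqF ?N //.
  rewrite filter_cat (eq_in_filter (a2 := pred0)) ?filter_pred0 /=; last by move=> e ->.
  apply/all_filterP/allP => e ew; apply: contraL ew => /sl; rewrite !inE.
  by case/orP => /eqP ->; rewrite (nin w).
have avt r r' : subseq r v -> subseq r' t -> avoids [:: c.1.1; d.1.1] (r ++ r').
  by move=> rv rt; rewrite avoids_cat (avoids_subseq rv) // (avoids_subseq rt).
have kept_term : ssum (fun r => cval (c :: d :: r)) (v ++ s ++ t) = rsum (v ++ t).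
  apply: (@state_sum_replace _ _ _ [:: c.1.1; d.1.1] _ _ [::]) => //.
  - by rewrite /s; case: o {Hs s}; rewrite /= !inE !eqxx ?orbT.
  - by rewrite /s; case: o {Hs s}; rewrite /= !inE ?(barK, bar_eqF, N).
  - move=> r r' rv rt; apply: (drop [:: c; d]) => //; exact: avt.
move: Hs kept_term; rewrite {}/s; case: o => /= Hs kept_term.
  (* [o = true]: the two arrows are linked, so at most one of them is smoothed. *)
  rewrite {1}/rooted (@state_sum_pair _ _ _ _ c (d :: v)); last first.
    by rewrite inE N nin.
  rewrite -[_ ++ bar c :: bar d :: t]/(d :: v ++ [:: bar c] ++ bar d :: t) catA.
  rewrite state_sum_pair; last by rewrite mem_cat !inE bar_eq N nin.
  rewrite -catA kept_term Kdc.
  have -> : rsum (d :: v) = rsum v.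
    by apply: (@rooted_remove _ _ _ [:: c.1.1; d.1.1] [::] [:: d]) => //=;
      rewrite !inE ?eqxx ?orbT ?bar_eqF.
  have -> : rsum (v ++ [:: bar c]) = rsum v.
    rewrite -[in RHS](cats0 v) -[[:: bar c]]cats0.
    by apply: (@rooted_remove _ _ _ [:: c.1.1; d.1.1] _ [:: bar c]) => //=;
      rewrite !inE ?eqxx ?orbT ?barK ?bar_eqF.
  rewrite state_sum_solo ?barK ?nin //.
  have -> : ssum (fun r => cval (bar d :: r)) t = ssum cval t.
    apply: eq_state_sum => r rt; have ar := avoids_subseq rt at_.
    apply: (@component_drop _ _ [:: bar d]) => /=; first by rewrite inE barK bar_eqF nin.
    by rewrite mem_head filter_avoids //; apply: sub_all ar => e;
      rewrite /= !inE negb_or => /andP[].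
  have -> : ssum (fun r => cval (c :: r)) t = ssum cval t.
    apply: eq_state_sum => r rt; have ar := avoids_subseq rt at_.
    by apply: (drop [:: c]) => // e; rewrite !inE => ->.
  by rewrite mulNr scalerN addrNK.
(* [o = false]: the arrows are unlinked, but smoothing both leaves an empty component between them,
   killed by [g0]. *)
rewrite {1}/rooted -[bar d :: bar c :: t]/([:: bar d] ++ bar c :: t) catA -cat_cons.
rewrite state_sum_pair; last by rewrite inE mem_cat inE bar_eq !N nin.
rewrite cat_cons -catA /= state_sum_pair ?nin // kept_term Kdc.
rewrite [ssum _ (bar c :: t)]state_sum_solo ?barK ?nin //.
have -> : ssum (fun r => cval (c :: bar c :: r)) t = ssum cval t.
  exact: eq_state_sum.
have -> : rsum (d :: v ++ [:: bar d]) = rsum v.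
  rewrite /rooted state_sum_pair ?nin // state_sum_nil /component /= g0 mulr0 scaler0 addr0.
  rewrite state_sum_last; last by rewrite barK nin.
  by apply: eq_state_sum.
by rewrite mulNr scalerN addrNK.
Qed.

(** * Move (c) at the base point *)

Section Triangle.

Variables al q be : dendpt.
Hypotheses (alq : al.1.1 != q.1.1) (albe : al.1.1 != be.1.1) (qbe : q.1.1 != be.1.1).

Local Notation L := [:: al.1.1; q.1.1; be.1.1].

Let notin3 w : avoids L w ->
  ((al \in w) = false) * ((bar al \in w) = false) * ((q \in w) = false) *
  ((bar q \in w) = false) * ((be \in w) = false) * ((bar be \in w) = false).
Proof. by move=> aw; rewrite !(notin_avoids aw) ?inE ?eqxx ?orbT. Qed.

Let filter3 l w : avoids L w -> all (fun e => e.1.1 \in L) l ->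
  [seq e <- w | e \notin l] = w.
Proof.
move=> /allP aw /allP lL; apply/all_filterP/allP => e /aw; apply: contra; exact: lL.
Qed.

Let neqs := (label_neq alq, label_neq albe, label_neq qbe, bar_eqF, bar_eq, barK).

Ltac letters := rewrite /= ?(mem_cat, inE) ?negb_or ?neqs ?notin3 ?eqxx ?orbT //.
Ltac filters :=
  rewrite /= ?inE ?neqs ?eqxx ?orbT /=;
  do ?(rewrite filter_cat /= ?inE ?neqs ?eqxx ?orbT /=);
  rewrite ?filter3 //= ?inE ?eqxx ?orbT //.
Ltac drop l := rewrite (@component_drop _ g l _ _ _ erefl); [filters | by letters].
Ltac drop_both l :=
  rewrite [LHS](@component_drop _ g l _ _ _ erefl); [|by letters];
  rewrite [RHS](@component_drop _ g l _ _ _ erefl); [by filters | by letters].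

(** Compares the states that keep [al] and [be]. If [q] is kept as well, the root words differ by
    move (c). If [q] is smoothed, [al] and [be] form a pair removable by move (b) in the left word,
    whereas in the right word they are linked with [q] and drop out. *)
Lemma triangle_rest v1 v2 v3 :
  avoids L v1 -> avoids L v2 -> avoids L v3 ->
  (forall r1 r2 r3, subseq r1 v1 -> subseq r2 v2 -> subseq r3 v3 ->
     cval (bar be :: bar al :: r1 ++ al :: q :: r2 ++ bar q :: be :: r3) =
     cval (bar al :: bar be :: r1 ++ q :: al :: r2 ++ be :: bar q :: r3)) ->
  (forall r1 r3, subseq r1 v1 -> subseq r3 v3 ->
     cval (bar be :: bar al :: r1 ++ al :: be :: r3) = cval (r1 ++ r3)) ->
  ssum (fun r => cval (bar be :: bar al :: r))
     (v1 ++ al :: q :: v2 ++ bar q :: be :: v3) =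
  ssum (fun r => cval (bar al :: bar be :: r))
     (v1 ++ q :: al :: v2 ++ be :: bar q :: v3).
Proof.
move=> a1 a2 a3 Hc Hb.
have sub v r : avoids L v -> subseq r v -> avoids L r by move=> av /avoids_subseq; apply.
rewrite (@state_sum_site _ _ _ v1 _ (q :: al :: v2 ++ be :: bar q :: v3) _
  (fun r => cval (bar al :: bar be :: r)) (fun=> 0) 0); first by rewrite mulr0 addr0.
- move=> v1a c v1b Dv1 cv1b.
  have cL : c.1.1 \notin L by move: a1; rewrite Dv1 avoids_cat => /andP[_] /= /andP[].
  have [ncal ncq ncbe] : [/\ c.1.1 != al.1.1, c.1.1 != q.1.1 & c.1.1 != be.1.1].
    by move: cL; rewrite !inE !negb_or => /and3P.
  move: (a1); rewrite Dv1 avoids_cat /= => /and3P[a1a _ a1b].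
  have nc := (label_neq ncal, label_neq ncq, label_neq ncbe, bar_eq).
  have [/split_first [v2a] [v2b] [Dv2 cv2a]|cv2] := boolP (bar c \in v2).
    move: a2; rewrite Dv2 avoids_cat /= => /and3P[a2a _ a2b]; right.
    exists (al :: q :: v2a), (v2b ++ bar q :: be :: v3),
           (q :: al :: v2a), (v2b ++ be :: bar q :: v3).
    split; rewrite /= -?catA ?inE ?nc //.
      transitivity (rsum (v1b ++ v2a)); [|apply/esym].
        by apply: (@rooted_remove _ _ _ L _ [:: al; q]) => //; letters.
      by apply: (@rooted_remove _ _ _ L _ [:: q; al]) => //; letters.
    move=> r /(sub _ _ a1a) ar.
    apply: (@state_sum_replace _ _ _ L _ [:: bar q; be] [:: be; bar q]) => //;
      try by letters.
    + move=> x y /(sub _ _ a2b) ax /(sub _ _ a3) ay.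
      by drop_both [:: bar al; bar q].
    + move=> x y /(sub _ _ a2b) ax /(sub _ _ a3) ay.
      by drop_both [:: bar al; bar be].
  have [/split_first [v3a] [v3b] [Dv3 cv3a]|cv3] := boolP (bar c \in v3); [right | left].
    move: a3; rewrite Dv3 avoids_cat /= => /and3P[a3a _ a3b].
    exists (al :: q :: v2 ++ bar q :: be :: v3a), v3b, 
           (q :: al :: v2 ++ be :: bar q :: v3a), v3b.
    split; rewrite /= -?catA ?inE ?mem_cat ?inE ?nc ?(negPf cv2) ?(negPf cv3a) //=.
      rewrite [LHS](@rooted_drop _ iota g [:: al; be] _ _ _ erefl); last by letters.
      rewrite [RHS](@rooted_drop _ iota g [:: al; be] _ _ _ erefl); last by letters.
      by filters.
    move=> r /(sub _ _ a1a) ar; apply: eq_state_sum => s /(sub _ _ a3b) as_.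
    by drop_both [:: bar al; bar be].
  by rewrite !inE !mem_cat !inE !nc (negPf cv2) (negPf cv3).
- move=> r1 rv1; have ar1 := sub _ _ a1 rv1; rewrite scaler0 addr0.
  rewrite state_sum_solo; last by letters.
  rewrite state_sum_pair ?notin3 // [ssum _ (be :: v3)]state_sum_solo ?notin3 //.
  rewrite -[be :: bar q :: v3]/([:: be] ++ bar q :: v3) catA -[al :: _ ++ _]cat_cons.
  rewrite state_sum_pair; last by letters.
  congr (_ + _ *: (K _ _ * _)).
  + rewrite cat_cons -catA /= [RHS]state_sum_solo; last by letters.
    apply: (@state_sum_replace _ _ _ L _ [:: bar q; be] [:: be; bar q]) => //;
      try by letters.
      by move=> r2 r3 rv2 rv3; apply: Hc.
    move=> x y /(sub _ _ a2) ax /(sub _ _ a3) ay.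
    by drop_both [:: bar be; q].
  + rewrite [RHS](@rooted_drop _ iota g [:: al; be] _ _ _ erefl); last by letters.
    by filters; rewrite cats0.
  + apply: eq_state_sum => r3 rv3; have ar3 := sub _ _ a3 rv3.
    rewrite Hb //; apply/esym; by drop [:: bar al; bar be].
Qed.

(** Expands the component split off by [be] in the states that keep [al]: either [q] is kept, and
    move (b) removes both arrows, or [q] is smoothed, and [al] becomes isolated. *)
Lemma triangle_child v1 v2 :
  avoids L v1 -> avoids L v2 ->
  (forall r1, subseq r1 v1 -> cval (bar al :: r1 ++ [:: al]) = cval r1) ->
  (forall r1 r2, subseq r1 v1 -> subseq r2 v2 ->
     cval (bar al :: r1 ++ al :: q :: r2 ++ [:: bar q]) = cval (r1 ++ r2)) ->
  ssum (fun r => cval (bar al :: r)) (v1 ++ al :: q :: v2 ++ [:: bar q]) =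
    rsum (v1 ++ v2) + rsum v1 * (zeta *: K q (rsum v2)).
Proof.
move=> a1 a2 Hal Hb.
have sub v r : avoids L v -> subseq r v -> avoids L r by move=> av /avoids_subseq; apply.
apply: state_sum_site => [v1a c v1b Dv1 cv1b|r1 rv1].
- have cL : c.1.1 \notin L by move: a1; rewrite Dv1 avoids_cat => /andP[_] /= /andP[].
  have [ncal ncq] : c.1.1 != al.1.1 /\ c.1.1 != q.1.1.
    by move: cL; rewrite !inE !negb_or => /and3P[].
  move: (a1); rewrite Dv1 avoids_cat /= => /and3P[a1a _ a1b].
  have nc := (label_neq ncal, label_neq ncq, bar_eq).
  have [/split_first [v2a] [v2b] [Dv2 cv2a]|cv2] := boolP (bar c \in v2); [right | left].
    move: a2; rewrite Dv2 avoids_cat /= => /and3P[a2a _ a2b].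
    exists (al :: q :: v2a), (v2b ++ [:: bar q]), v2a, v2b.
    split; rewrite /= -?catA ?inE ?nc //.
      by apply: (@rooted_remove _ _ _ L _ [:: al; q]) => //; letters.
    move=> r /(sub _ _ a1a) ar; rewrite state_sum_last ?barK ?notin3 //.
    apply: eq_state_sum => s /(sub _ _ a2b) as_.
    by drop [:: bar al; bar q]; rewrite cats0.
  by rewrite !inE !mem_cat !inE !nc (negPf cv2).
- have ar1 := sub _ _ a1 rv1; rewrite state_sum_solo; last by letters.
  rewrite state_sum_pair ?notin3 // state_sum_nil state_sum_last ?barK ?notin3 //.
  rewrite Hal // mulrC mul_polyC scalerA mulrC -scalerA; congr (_ + _).
  by apply: eq_state_sum => r2 rv2; apply: Hb.
Qed.

(** In the right word the three arrows are pairwise linked, so at most one is smoothed, and these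
    states match those of the left word. In the left word no two are linked. Smoothing all three
    leaves an empty component and gives 0; smoothing two gives in total [zeta ^+ 2] times the left
    side of the hypothesis on [K], times [rsum v3], hence 0. *)
Lemma rooted_triangle v1 v2 v3 :
  avoids L v1 -> avoids L v2 -> avoids L v3 ->
  (forall f1 f2, K (bar be) (K (bar al) f1 * f2 + K q f2 * f1) + K (bar al) f1 * K q f2 = 0) ->
  (forall r1 r2 r3, subseq r1 v1 -> subseq r2 v2 -> subseq r3 v3 ->
     cval (bar be :: bar al :: r1 ++ al :: q :: r2 ++ bar q :: be :: r3) =
     cval (bar al :: bar be :: r1 ++ q :: al :: r2 ++ be :: bar q :: r3)) ->
  (forall r3, subseq r3 v3 -> cval (bar be :: be :: r3) = cval r3) ->
  (forall r2, subseq r2 v2 -> cval (q :: r2 ++ [:: bar q]) = cval r2) ->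
  (forall r1, subseq r1 v1 -> cval (bar al :: r1 ++ [:: al]) = cval r1) ->
  (forall r1 r2, subseq r1 v1 -> subseq r2 v2 ->
     cval (bar al :: r1 ++ al :: q :: r2 ++ [:: bar q]) = cval (r1 ++ r2)) ->
  (forall r2 r3, subseq r2 v2 -> subseq r3 v3 ->
     cval (bar be :: q :: r2 ++ bar q :: be :: r3) = cval (r2 ++ r3)) ->
  (forall r1 r3, subseq r1 v1 -> subseq r3 v3 ->
     cval (bar be :: bar al :: r1 ++ al :: be :: r3) = cval (r1 ++ r3)) ->
  rsum (bar be :: bar al :: v1 ++ al :: q :: v2 ++ bar q :: be :: v3) =
  rsum (bar al :: bar be :: v1 ++ q :: al :: v2 ++ be :: bar q :: v3).
Proof.
move=> a1 a2 a3 KK Hc Hbe Hq Hal Halq Hbeq Halbe.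
have sub v r : avoids L v -> subseq r v -> avoids L r by move=> av /avoids_subseq; apply.
have rest := triangle_rest a1 a2 a3 Hc Halbe.
have child := triangle_child a1 a2 Hal Halq.
have q_wrap : rsum (q :: v2 ++ [:: bar q]) = rsum v2.
  rewrite /rooted state_sum_pair ?notin3 // state_sum_nil /component /= g0.
  rewrite mulr0 scaler0 addr0 state_sum_last ?barK ?notin3 //; exact: eq_state_sum.
have x1 : rsum (bar al :: v1 ++ al :: q :: v2 ++ [:: bar q]) =
    rsum (v1 ++ v2) + rsum v1 * (zeta *: K q (rsum v2))
    + zeta *: (K (bar al) (rsum v1) * rsum v2).
  rewrite {1}/rooted -{2}(barK al) state_sum_pair barK ?notin3 // child.
  by rewrite -/(rooted iota g _) q_wrap.
have s23 : ssum (fun r => cval (bar be :: q :: r)) (v2 ++ [:: bar q; be] ++ v3) =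
    rsum (v2 ++ v3).
  apply: (@state_sum_replace _ _ _ L _ _ [::]) => //; try by letters.
  by move=> r r' /(sub _ _ a2) ar /(sub _ _ a3) ar'; drop [:: bar be; q].
have s23' : rsum (v2 ++ [:: be; bar q] ++ v3) = rsum (v2 ++ v3).
  by apply: (@rooted_remove _ _ _ L) => //; letters.
have y1 : ssum (fun r => cval (bar be :: r)) (q :: v2 ++ bar q :: be :: v3) =
    rsum (v2 ++ v3) + zeta *: (K q (rsum v2) * rsum v3).
  rewrite state_sum_pair ?notin3 // s23 [ssum _ (be :: _)]state_sum_solo ?notin3 //.
  congr (_ + _ *: (_ * _)); exact: eq_state_sum.
have lhs : rsum (bar be :: bar al :: v1 ++ al :: q :: v2 ++ bar q :: be :: v3) =
    ssum (fun r => cval (bar be :: bar al :: r))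
      (v1 ++ al :: q :: v2 ++ bar q :: be :: v3)
    + zeta *: (K (bar al) (rsum v1) * (rsum (v2 ++ v3) + zeta *: (K q (rsum v2) * rsum v3)))
    + zeta *: (K (bar be) (rsum (v1 ++ v2) + rsum v1 * (zeta *: K q (rsum v2))
         + zeta *: (K (bar al) (rsum v1) * rsum v2)) * rsum v3).
  have -> : bar be :: bar al :: v1 ++ al :: q :: v2 ++ bar q :: be :: v3 =
      bar be :: (bar al :: v1 ++ al :: q :: v2 ++ [:: bar q]) ++ bar (bar be) :: v3.
    by rewrite barK /= -!catA /= -!catA.
  rewrite {1}/rooted state_sum_pair; last by letters.
  rewrite x1; congr (_ + _); rewrite barK /= -!catA /= -!catA /=.
  by rewrite -{2}(barK al) state_sum_pair barK ?notin3 // y1.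
have rhs : rsum (bar al :: bar be :: v1 ++ q :: al :: v2 ++ be :: bar q :: v3) =
    ssum (fun r => cval (bar al :: bar be :: r))
      (v1 ++ q :: al :: v2 ++ be :: bar q :: v3)
    + zeta *: (K (bar be) (rsum (v1 ++ v2)) * rsum v3)
    + zeta *: (K (bar al) (rsum v1) * rsum (v2 ++ v3)).
  have -> : bar al :: bar be :: v1 ++ q :: al :: v2 ++ be :: bar q :: v3 =
      bar al :: (bar be :: v1 ++ [:: q]) ++ bar (bar al) :: v2 ++ be :: bar q :: v3.
    by rewrite barK /= -!catA.
  rewrite {1}/rooted state_sum_pair; last by letters.
  have -> : rsum (bar be :: v1 ++ [:: q]) = rsum v1.
    by apply: (@rooted_drop _ _ _ [:: bar be; q]); [letters | filters; rewrite cats0].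
  rewrite -[be :: bar q :: v3]/([:: be; bar q] ++ v3) -/(rooted iota g _) s23'; congr (_ + _).
  have -> : (bar be :: v1 ++ [:: q]) ++ bar (bar al) :: v2 ++ [:: be; bar q] ++ v3 =
      bar be :: (v1 ++ q :: al :: v2) ++ bar (bar be) :: bar q :: v3.
    by rewrite !barK /= -!catA.
  rewrite state_sum_pair; last by letters.
  have -> : rsum (v1 ++ q :: al :: v2) = rsum (v1 ++ v2).
    by apply: (@rooted_remove _ _ _ L _ [:: q; al]) => //; letters.
  rewrite [ssum _ (bar q :: v3)]state_sum_solo ?barK ?notin3 // -!catA /=.
  congr (_ + _ *: (_ * _)); apply: eq_state_sum => r /(sub _ _ a3) ar.
  by drop [:: bar al; bar q].
rewrite lhs rhs rest.
have := KK (rsum v1) (rsum v2); move: (rsum v1) (rsum v2) => f1 f2.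
have KD u v : K (bar be) (u + v) = K (bar be) u + K (bar be) v by exact: linearD.
have KZ a u : K (bar be) (a *: u) = a *: K (bar be) u by exact: linearZ.
move=> /eqP; rewrite addr_eq0 => /eqP K12; rewrite KD in K12.
rewrite -[f1 * _]scalerAr !KD !KZ [f1 * _]mulrC.
rewrite (canRL (addKr _) K12).
rewrite -!mul_polyC; ring.
Qed.

End Triangle.

End Reidemeister.

Ltac counting := apply/permP => ?; rewrite /= ?(count_cat, size_cat) /=
  ?(count_cat, size_cat) /= ?(count_cat, size_cat) /= ?negbK;
  repeat match goal with |- context [nat_of_bool ?e] => generalize (nat_of_bool e) => ? end;
  clear; lia.

Definition unsign (w : seq dendpt) : seq sendpt := [seq e.1 | e <- w].

Lemma unsign_cat v w : unsign (v ++ w) = unsign v ++ unsign w.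
Proof. exact: map_cat. Qed.

Lemma wf_diag_uniq w : wf_diag w -> uniq (unsign w).
Proof. by case/andP. Qed.

Lemma wf_dkeep w : uniq (unsign w) -> wf_diag (dkeep w).
Proof.
move=> uw; apply/andP; split.
  by apply: subseq_uniq uw; apply: map_subseq; apply: filter_subseq.
apply/allP => e; rewrite mem_filter => /andP[be ew].
by rewrite mem_filter be -/(bar e) -/(bar (bar e)) barK ew.
Qed.

Lemma dkeep_id w : wf_diag w -> dkeep w = w.
Proof. by case/andP => _ cw; apply/all_filterP. Qed.

Lemma wf_unsign w : wf_diag w -> wf_str (unsign w).
Proof.
case/andP => uw /allP cw; rewrite /wf_str uw /=; apply/allP => _ /mapP[e ew ->] /=.
exact: (map_f fst (cw _ ew)).
Qed.

Lemma wf_str_perm v w : perm_eq v w -> wf_str v = wf_str w.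
Proof.
move=> vw; rewrite /wf_str (perm_uniq vw) (perm_all _ vw); congr (_ && _).
by apply: eq_all => e; rewrite (perm_mem vw).
Qed.

Lemma wf_diag_perm v w : perm_eq v w -> wf_diag v = wf_diag w.
Proof.
move=> vw; rewrite /wf_diag (perm_uniq (perm_map _ vw)) (perm_all _ vw); congr (_ && _).
by apply: eq_all => e; rewrite (perm_mem vw).
Qed.

Lemma subseq_size_eq (T : eqType) (r v : seq T) :
  subseq r v -> (size v <= size r)%N -> r = v.
Proof. by move=> rv le; apply/eqP; rewrite -(size_subseq_leqif rv) eqn_leq (size_subseq rv). Qed.

(** * Invariance of the state sum from invariance of [g] in lower order *)

Section Invariance.

Variables (A : comNzRingType) (iota : {rmorphism {poly rat} -> A}).
Implicit Types (g : seq sendpt -> A) (N : nat).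

(* Invariance under the moves with the base point placed just before the first
   arc involved, for words of length less than [N].  Both orientations of an
   isolated arrow are included; [inv_triangle] is the first version of move (c)
   for [b = false], and the second one read backwards for [b = true]. *)
Record invariant_below g N : Prop := InvariantBelow {
  inv_nil : g [::] = 0;
  inv_rot e w : wf_str (e :: w) -> (size (e :: w) < N)%N -> g (e :: w) = g (w ++ [:: e]);
  inv_isolated p b w :
    let d := [:: (p, b), (p, ~~ b) & w] in
    wf_str d -> (size d < N)%N -> g d = g w;
  inv_bigon p q b (o : bool) v w :
    let s := if o then [:: (p, ~~ b); (q, b)] else [:: (q, b); (p, ~~ b)] in
    let d := [:: (p, b), (q, ~~ b) & v ++ s ++ w] in
    wf_str d -> (size d < N)%N -> g d = g (v ++ w);
  inv_triangle p q r b v1 v2 v3 :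
    let d := [:: (r, ~~ b), (p, b) &
                v1 ++ [:: (p, ~~ b), (q, b) & v2 ++ [:: (q, ~~ b), (r, b) & v3]]] in
    wf_str d -> (size d < N)%N ->
    g d = g [:: (p, b), (r, ~~ b) &
                v1 ++ [:: (q, b), (p, ~~ b) & v2 ++ [:: (r, b), (q, ~~ b) & v3]]]
}.

Variables (g : seq sendpt -> A).
Local Notation cval := (component g).
Local Notation csum := (closed_sum iota g).

Lemma inv_wrap N p b w : invariant_below g N ->
  wf_str ((p, b) :: w ++ [:: (p, ~~ b)]) -> ((size w).+2 < N)%N ->
  g ((p, b) :: w ++ [:: (p, ~~ b)]) = g w.
Proof.
move=> inv wf sw; rewrite -cat_cons -(inv_rot inv) /=.
- rewrite -{2}(negbK b) (inv_isolated inv) //= negbK.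
  by rewrite -(wf_str_perm (_ : perm_eq ((p, b) :: w ++ [:: (p, ~~ b)]) _)) // -cat_cons perm_catC.
- by rewrite -(wf_str_perm (_ : perm_eq ((p, b) :: w ++ [:: (p, ~~ b)]) _)) // -cat_cons perm_catC.
- by [].
Qed.

Lemma component_sites L s0 s1 s2 s0' s1' s2' v1 v2 v3 :
  avoids L v1 -> avoids L v2 -> avoids L v3 ->
  all (fun e => e.1.1 \in L) (s0 ++ s1 ++ s2) ->
  all (fun e => e.1.1 \in L) (s0' ++ s1' ++ s2') ->
  all (fun e => bar e \in s0 ++ s1 ++ s2) (s0 ++ s1 ++ s2) ->
  all (fun e => bar e \in s0' ++ s1' ++ s2') (s0' ++ s1' ++ s2') ->
  uniq (unsign (s0 ++ v1 ++ s1 ++ v2 ++ s2 ++ v3)) ->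
  (forall r1 r2 r3, subseq r1 v1 -> subseq r2 v2 -> subseq r3 v3 ->
     wf_diag (s0 ++ r1 ++ s1 ++ r2 ++ s2 ++ r3) ->
     g (unsign (s0 ++ r1 ++ s1 ++ r2 ++ s2 ++ r3)) =
     g (unsign (s0' ++ r1 ++ s1' ++ r2 ++ s2' ++ r3))) ->
  forall r1 r2 r3, subseq r1 v1 -> subseq r2 v2 -> subseq r3 v3 ->
    cval (s0 ++ r1 ++ s1 ++ r2 ++ s2 ++ r3) =
    cval (s0' ++ r1 ++ s1' ++ r2 ++ s2' ++ r3).
Proof.
move=> a1 a2 a3 sL sL' cl cl' u H r1 r2 r3 rv1 rv2 rv3.
have ar : avoids L (r1 ++ r2 ++ r3).
  by rewrite !avoids_cat (avoids_subseq rv1) // (avoids_subseq rv2) // (avoids_subseq rv3).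
have wf : wf_diag (dkeep (s0 ++ r1 ++ s1 ++ r2 ++ s2 ++ r3)).
  apply: wf_dkeep; apply: subseq_uniq u; apply: map_subseq.
  by do !apply: cat_subseq.
rewrite /component -!/(unsign _) (dkeep_sites ar sL' cl').
move: wf; rewrite (dkeep_sites ar sL cl) => wf.
by apply: H => //; apply: subseq_trans (filter_subseq _ _) _.
Qed.

(** A component other than the full word is shorter than the bound in [inv]; the full word occurs
    only in the state without smoothings and is covered by the last hypothesis. The same division is
    used for the other moves below. *)
Lemma closed_sum_rot c w : wf_diag (c :: w) -> invariant_below g (size (c :: w)) ->
  g (unsign (c :: w)) = g (unsign (w ++ [:: c])) ->
  csum (c :: w) = csum (w ++ [:: c]).
Proof.
move=> wf inv top; apply: closed_sum_rot_component => [|r rw].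
  exact: map_uniq (wf_diag_uniq wf).
have [szr|] := ltnP (size r) (size w); last first.
  move=> /(subseq_size_eq rw) ->; rewrite /component !dkeep_id //.
  by rewrite -(wf_diag_perm (_ : perm_eq (c :: w) _)) // -cat1s perm_catC.
rewrite /component -!/(unsign _).
have -> : dkeep (r ++ [:: c]) = [seq e <- r ++ [:: c] | bar e \in c :: r].
  by apply: eq_filter => e; rewrite -/(bar e) mem_cat !inE orbC.
have : wf_diag (dkeep (c :: r)).
  apply: wf_dkeep; apply: subseq_uniq (wf_diag_uniq wf); apply: map_subseq.
  by rewrite /= eqxx.
have : (size (dkeep (c :: r)) < size (c :: w))%N.
  by apply: leq_ltn_trans (size_subseq (filter_subseq _ _)) _.
rewrite filter_cat unsign_cat /dkeep /= -/(bar c).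
case: (bar c \in c :: r) => /= sz wf'; last by rewrite cats0.
by apply: (inv_rot inv); [exact: (wf_unsign wf') | rewrite /= size_map].
Qed.

Lemma avoids_wf p b s x y (w : seq dendpt) :
  uniq (unsign w) -> perm_eq w [:: (p, b, s), (p, ~~ b, s) & x ++ y] ->
  avoids [:: p] x /\ avoids [:: p] y.
Proof.
move=> uw pw; apply/andP; rewrite -avoids_cat.
have : uniq (unsign [:: (p, b, s), (p, ~~ b, s) & x ++ y]).
  by rewrite -(perm_uniq (perm_map fst pw)).
rewrite /= inE negb_or => /and3P[/andP[_ n1] n2 _].
apply/allP => -[[p' b'] s'] e'; rewrite inE /=; apply/eqP => Ep; subst p'.
have [Eb|Eb] := eqVneq b' b.
  by case/negP: n1; rewrite -Eb; apply/mapP; exists (p, b', s').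
have Eb' : b' = ~~ b by move: Eb; case: (b); case: (b').
by case/negP: n2; rewrite -Eb'; apply/mapP; exists (p, b', s').
Qed.

Lemma closed_sum_isolated p b s v :
  let c := (p, b, s) in
  wf_diag (c :: bar c :: v) -> invariant_below g (size (c :: bar c :: v)) ->
  g (unsign (c :: bar c :: v)) = g (unsign v) ->
  csum (c :: bar c :: v) = csum v.
Proof.
move=> c wf inv top; congr integral.
have [_ av] := @avoids_wf p b s [::] v _ (wf_diag_uniq wf) (perm_refl _).
apply: rooted_isolated; first exact: inv_nil inv.
  by rewrite (notin_avoids av) ?mem_head.
move=> r rv; rewrite -[r]cats0.
apply: (@component_sites [:: p] [:: c; bar c] [::] [::] [::] [::] [::] v [::] [::]
   _ _ _ _ _ _ _ _ _ r [::] [::]) => //.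
- by rewrite /= !inE eqxx.
- by rewrite /= !inE barK !eqxx orbT.
- by rewrite /= cats0; exact: (wf_diag_uniq wf).
move=> {r rv} r r2 r3 rv; rewrite !subseq0 => /eqP-> /eqP->; rewrite ?cats0 => wfr.
have [szr|/(subseq_size_eq rv) -> //] := ltnP (size r) (size v).
by apply: (inv_isolated inv); [exact: (wf_unsign wfr) | rewrite /= size_map].
Qed.

Lemma uniq_unsign_perm (u rest w : seq dendpt) :
  uniq (unsign w) -> perm_eq w (u ++ rest) -> uniq (unsign u).
Proof.
move=> uw pw; have : uniq (unsign (u ++ rest)) by rewrite -(perm_uniq (perm_map fst pw)).
by rewrite unsign_cat cat_uniq => /andP[].
Qed.

Lemma avoids_cons p L w : avoids (p :: L) w = avoids [:: p] w && avoids L w.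
Proof. by rewrite /avoids -all_predI; apply: eq_all => e; rewrite /= !inE negb_or. Qed.

Lemma closed_sum_bigon p q b s (o : bool) v t :
  let c := (p, b, s) in let d := (q, ~~ b, ~~ s) in
  let x := if o then [:: bar c; bar d] else [:: bar d; bar c] in
  let w := c :: d :: v ++ x ++ t in
  wf_diag w -> invariant_below g (size w) -> g (unsign w) = g (unsign (v ++ t)) ->
  csum w = csum (v ++ t).
Proof.
move=> c d x w wf inv top; congr integral.
have uw := wf_diag_uniq wf.
have [ad av] := @avoids_wf p b s [:: d; bar d] (v ++ t) w uw
   ltac:(rewrite /w /x /c /d /bar; case: (o); counting).
have [_ aq] := @avoids_wf q (~~ b) (~~ s) [:: c; bar c] (v ++ t) w uw
   ltac:(rewrite /w /x /c /d /bar; case: (o); counting).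
move: av aq; rewrite !avoids_cat => /andP[avp atp] /andP[avq atq].
have [av at_] : avoids [:: p; q] v /\ avoids [:: p; q] t.
  by split; rewrite avoids_cons; apply/andP.
have pq : p != q.
  by move: ad => /andP[]; rewrite !inE eq_sym.
have sz r r' : subseq r v -> subseq r' t -> (size (r ++ r') < size (v ++ t))%N \/ r = v /\ r' = t.
  move=> rv rt; have := (size_subseq rv, size_subseq rt); rewrite !size_cat => -[le le'].
  have [lt|ge] := ltnP (size r + size r') (size v + size t); [by left | right].
  split; apply: subseq_size_eq => //.
    by rewrite -(leq_add2r (size t)); apply: leq_trans ge _; rewrite leq_add2l.
  by rewrite -(leq_add2l (size v)); apply: leq_trans ge _; rewrite leq_add2r.
have sw : size w = (size v + size t).+4.
  by rewrite /w /x; case: (o); rewrite /= !size_cat /= !addnS.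
rewrite sw in inv; apply: rooted_bigon => //=.
- exact: inv_nil inv.
- by move=> f; rewrite /weight_of /= weightN.
- move=> r r' rv rt; rewrite -[r']cats0.
  apply: (@component_sites [:: p; q] [:: c; d] x [::] [::] [::] [::] v t [::]
    _ _ _ _ _ _ _ _ _ r r' [::]) => //.
  + by rewrite /x; case: (o); rewrite /= !inE !eqxx ?orbT.
  + by rewrite /x; case: (o); rewrite /= !inE !barK !eqxx ?orbT.
  + by rewrite /= cats0; exact: uw.
  move=> {r r' rv rt} r r' r3 rv rt; rewrite !subseq0 => /eqP->; rewrite ?cats0 => wfr.
  have [lt|[-> ->] //] := sz _ _ rv rt.
  move: (wf_unsign wfr); rewrite /= /x; case: (o); rewrite /= !unsign_cat /= negbK => wfr';
    [have /= H := @inv_bigon _ _ inv p q b true | have /= H := @inv_bigon _ _ inv p q b false];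
    apply: H => //; move: lt; rewrite /= ?(size_cat, size_map) /= ?(size_cat, size_map) /=;
    clear; lia.
- move=> r rv; rewrite -[in RHS](cats0 r).
  apply: (@component_sites [:: p; q] [:: d] [:: bar d] [::] [::] [::] [::] v [::] [::]
    _ _ _ _ _ _ _ _ _ r [::] [::]) => //.
  + by rewrite /= !inE !eqxx ?orbT.
  + by rewrite /= !inE !barK !eqxx ?orbT.
  + by apply: (@uniq_unsign_perm _ (c :: bar c :: t) w uw); rewrite /w /x /c /d /bar; case: (o); counting.
  move=> {r rv} r r2 r3 rv; rewrite !subseq0 => /eqP-> /eqP->; rewrite ?cats0 => wfr.
  move: (wf_unsign wfr); rewrite /= !unsign_cat /= => wfr'.
  apply: (inv_wrap inv) => //; rewrite size_map !ltnS.
  by apply: leq_trans (size_subseq rv) _; rewrite leqW // leq_addr.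
- move=> r rt; rewrite -[r]cats0.
  apply: (@component_sites [:: p; q] [:: c; bar c] [::] [::] [::] [::] [::] t [::] [::]
    _ _ _ _ _ _ _ _ _ r [::] [::]) => //.
  + by rewrite /= !inE !eqxx ?orbT.
  + by rewrite /= !inE !barK !eqxx ?orbT.
  + by apply: (@uniq_unsign_perm _ (d :: bar d :: v) w uw); rewrite /w /x /c /d /bar; case: (o); counting.
  move=> {r rt} r r2 r3 rt; rewrite !subseq0 => /eqP-> /eqP->; rewrite ?cats0 => wfr.
  apply: (inv_isolated inv); first exact: (wf_unsign wfr).
  rewrite /= size_map !ltnS.
  by apply: leq_trans (size_subseq rt) _; rewrite leqW // leq_addl.
Qed.

Lemma closed_sum_triangle p q r b v1 v2 v3 :
  let al := (p, ~~ b, ~~ b) in let d := (q, b, true) in let be := (r, b, b) in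
  let w := bar be :: bar al :: v1 ++ al :: d :: v2 ++ bar d :: be :: v3 in
  let w' := bar al :: bar be :: v1 ++ d :: al :: v2 ++ be :: bar d :: v3 in
  wf_diag w -> invariant_below g (size w) -> g (unsign w) = g (unsign w') ->
  csum w = csum w'.
Proof.
move=> al d be w w' wf inv top; congr integral.
have uw := wf_diag_uniq wf.
have [ap avp] := @avoids_wf p (~~ b) (~~ b) [:: d; be] ([:: bar d; bar be] ++ v1 ++ v2 ++ v3) w uw
   ltac:(rewrite /w /al /d /be /bar; counting).
have [aq avq] := @avoids_wf q b true [:: be] ([:: al; bar al; bar be] ++ v1 ++ v2 ++ v3) w uw
   ltac:(rewrite /w /al /d /be /bar; counting).
have [_ avr] := @avoids_wf r b b [::] ([:: al; bar al; d; bar d] ++ v1 ++ v2 ++ v3) w uw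
   ltac:(rewrite /w /al /d /be /bar; counting).
have [pq pr qr] : [/\ p != q, p != r & q != r].
  move: ap aq; rewrite /= !inE => /and3P[pq pr _] /andP[qr _].
  by rewrite [p == q]eq_sym [p == r]eq_sym [q == r]eq_sym.
move: avp avq avr; rewrite !avoids_cat => /and4P[_ av1p av2p av3p] /and4P[_ av1q av2q av3q]
  /and4P[_ av1r av2r av3r].
have av v : avoids [:: p] v -> avoids [:: q] v -> avoids [:: r] v -> avoids [:: p; q; r] v.
  by move=> a1 a2 a3; rewrite avoids_cons a1 avoids_cons a2.
have [a1 a2 a3] : [/\ avoids [:: p; q; r] v1, avoids [:: p; q; r] v2 & avoids [:: p; q; r] v3].
  by split; apply: av.
have sw : size w = (size v1 + size v2 + size v3).+4.+2.
  by rewrite /w /= !size_cat /= !size_cat /= !(addnS, addSn) addnA.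
rewrite sw in inv.
have sub x y n : subseq x y -> (size y <= n)%N -> (size (unsign x) <= n)%N.
  by move=> /size_subseq xy; rewrite size_map; apply: leq_trans.
have [l1 l2 l3] : [/\ size v1 <= size v1 + size v2 + size v3, 
    size v2 <= size v1 + size v2 + size v3 & size v3 <= size v1 + size v2 + size v3]%N.
  by clear; split; lia.
have [l12 l23 l13] : [/\ size v1 + size v2 <= size v1 + size v2 + size v3, 
    size v2 + size v3 <= size v1 + size v2 + size v3 &
    size v1 + size v3 <= size v1 + size v2 + size v3]%N.
  by clear; split; lia.
apply: rooted_triangle => //=.
- exact: inv_nil inv.
- by move=> f1 f2; rewrite /weight_of /= negbK weight_triangle.
- apply: (@component_sites [:: p; q; r] [:: bar be; bar al] [:: al; d] [:: bar d; be]
    [:: bar al; bar be] [:: d; al] [:: be; bar d] v1 v2 v3) => //.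
  1,2: by rewrite /= !inE !eqxx ?orbT.
  1,2: by rewrite /= !inE !barK !eqxx ?orbT.
  move=> r1 r2 r3 rv1 rv2 rv3 wfr.
  have s1 := size_subseq rv1; have s2 := size_subseq rv2; have s3 := size_subseq rv3.
  have [lt|ge] := ltnP (size r1 + size r2 + size r3) (size v1 + size v2 + size v3); last first.
    have [-> -> ->//] : [/\ r1 = v1, r2 = v2 & r3 = v3].
    split; apply: subseq_size_eq => //; rewrite leqNgt; apply: contraL ge => lt; rewrite -ltnNge.
    + by rewrite -!addSn; do !apply: leq_add.
    + by rewrite -addSn -addnS; do !apply: leq_add.
    + by rewrite -addnS; do !apply: leq_add.
  move: (wf_unsign wfr); rewrite /= !unsign_cat /= !unsign_cat /= !negbK => wfr'.
  apply: (inv_triangle inv) => //=.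
  by rewrite !size_cat /= !size_cat /= !size_map !(addnS, addSn) !ltnS addnA.
- move=> r3 rv3; rewrite -[r3]cats0.
  apply: (@component_sites [:: p; q; r] [:: bar be; be] [::] [::] [::] [::] [::] v3 [::] [::]
    _ _ _ _ _ _ _ _ _ r3 [::] [::]) => //.
  + by rewrite /= !inE !eqxx ?orbT.
  + by rewrite /= !inE !barK !eqxx ?orbT.
  + apply: (@uniq_unsign_perm _ ([:: al; bar al; d; bar d] ++ v1 ++ v2) w uw).
    by rewrite /w /al /d /be /bar; counting.
  move=> {r3 rv3} r3 r2 r1 rv3; rewrite !subseq0 => /eqP-> /eqP->; rewrite ?cats0 => wfr.
  have := wf_unsign wfr; rewrite /= -{2 4}(negbK b) => wfr'; apply: (inv_isolated inv) => //=.
  by rewrite !ltnS; apply: sub rv3 _; rewrite leqW // leqW // leqW.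
- move=> r2 rv2; rewrite -[in RHS](cats0 r2).
  apply: (@component_sites [:: p; q; r] [:: d] [:: bar d] [::] [::] [::] [::] v2 [::] [::]
    _ _ _ _ _ _ _ _ _ r2 [::] [::]) => //.
  + by rewrite /= !inE !eqxx ?orbT.
  + by rewrite /= !inE !barK !eqxx ?orbT.
  + apply: (@uniq_unsign_perm _ ([:: al; bar al; be; bar be] ++ v1 ++ v3) w uw).
    by rewrite /w /al /d /be /bar; counting.
  move=> {r2 rv2} r2 r1 r3 rv2; rewrite !subseq0 => /eqP-> /eqP->; rewrite ?cats0 => wfr.
  move: (wf_unsign wfr); rewrite /= !unsign_cat /= => wfr'.
  apply: (inv_wrap inv) => //.
  by rewrite !ltnS; apply: sub rv2 _; rewrite leqW // leqW // leqW.
- move=> r1 rv1; rewrite -[in RHS](cats0 r1).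
  apply: (@component_sites [:: p; q; r] [:: bar al] [:: al] [::] [::] [::] [::] v1 [::] [::]
    _ _ _ _ _ _ _ _ _ r1 [::] [::]) => //.
  + by rewrite /= !inE !eqxx ?orbT.
  + by rewrite /= !inE !barK !eqxx ?orbT.
  + apply: (@uniq_unsign_perm _ ([:: d; bar d; be; bar be] ++ v2 ++ v3) w uw).
    by rewrite /w /al /d /be /bar; counting.
  move=> {r1 rv1} r1 r2 r3 rv1; rewrite !subseq0 => /eqP-> /eqP->; rewrite ?cats0 => wfr.
  move: (wf_unsign wfr); rewrite /= !unsign_cat /= negbK => wfr'.
  apply: (inv_wrap inv) => //.
  by rewrite !ltnS; apply: sub rv1 _; rewrite leqW // leqW // leqW.
- move=> r1 r2 rv1 rv2; rewrite -[in RHS](cats0 r2).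
  apply: (@component_sites [:: p; q; r] [:: bar al] [:: al; d] [:: bar d] [::] [::] [::] v1 v2 [::]
    _ _ _ _ _ _ _ _ _ r1 r2 [::]) => //.
  + by rewrite /= !inE !eqxx ?orbT.
  + by rewrite /= !inE !barK !eqxx ?orbT.
  + apply: (@uniq_unsign_perm _ ([:: be; bar be] ++ v3) w uw).
    by rewrite /w /al /d /be /bar; counting.
  move=> {r1 rv1 r2 rv2} r1 r2 r3 rv1 rv2; rewrite !subseq0 => /eqP->; rewrite ?cats0 => wfr.
  move: (wf_unsign wfr); rewrite /= !unsign_cat /= !unsign_cat /= negbK => wfr'.
  have bound : (size (unsign r1) + size (unsign r2) <= size v1 + size v2 + size v3)%N.
    by apply: leq_trans l12; apply: leq_add; apply: sub (leqnn _).
  (* One of the two arcs shared by these arrows contains the base point; moving the last letter to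
     the front gives the shape of [inv_bigon]. *)
  have rotated : (p, b) :: unsign r1 ++ (p, ~~ b) :: (q, b) :: unsign r2 ++ [:: (q, ~~ b)] =
      ((p, b) :: unsign r1 ++ [:: (p, ~~ b); (q, b)] ++ unsign r2) ++ [:: (q, ~~ b)].
    by rewrite /= -catA.
  have wfq : wf_str ((q, ~~ b) :: (p, b) :: unsign r1 ++ [:: (p, ~~ b); (q, b)] ++ unsign r2).
    by apply: etrans wfr'; apply: wf_str_perm; rewrite rotated perm_sym perm_catC.
  have szq : (size ((q, ~~ b) :: (p, b) :: unsign r1 ++ [:: (p, ~~ b); (q, b)] ++ unsign r2)
      < (size v1 + size v2 + size v3).+4.+2)%N.
    by rewrite /= !size_cat /= !(addnS, addSn) !ltnS leqW.
  rewrite rotated -(inv_rot inv) //.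
  by have /= H := @inv_bigon _ _ inv q p (~~ b) false; rewrite negbK in H; apply: H.
- move=> r2 r3 rv2 rv3; rewrite -[r3]cats0.
  apply: (@component_sites [:: p; q; r] [:: bar be; d] [:: bar d; be] [::] [::] [::] [::] v2 v3 [::]
    _ _ _ _ _ _ _ _ _ r2 r3 [::]) => //.
  + by rewrite /= !inE !eqxx ?orbT.
  + by rewrite /= !inE !barK !eqxx ?orbT.
  + apply: (@uniq_unsign_perm _ ([:: al; bar al] ++ v1) w uw).
    by rewrite /w /al /d /be /bar; counting.
  move=> {r2 rv2 r3 rv3} r2 r3 r1 rv2 rv3; rewrite !subseq0 => /eqP->; rewrite ?cats0 => wfr.
  move: (wf_unsign wfr); rewrite /= !unsign_cat /= => wfr'.
  have /= H := @inv_bigon _ _ inv r q (~~ b) false; rewrite negbK in H; apply: H => //.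
  rewrite !size_cat /= !(addnS, addSn) !ltnS leqW //.
  by apply: leq_trans l23; apply: leq_add; apply: sub (leqnn _).
- move=> r1 r3 rv1 rv3; rewrite -[r3]cats0.
  apply: (@component_sites [:: p; q; r] [:: bar be; bar al] [:: al; be] [::] [::] [::] [::] v1 v3 [::]
    _ _ _ _ _ _ _ _ _ r1 r3 [::]) => //.
  + by rewrite /= !inE !eqxx ?orbT.
  + by rewrite /= !inE !barK !eqxx ?orbT.
  + apply: (@uniq_unsign_perm _ ([:: d; bar d] ++ v2) w uw).
    by rewrite /w /al /d /be /bar; counting.
  move=> {r1 rv1 r3 rv3} r1 r3 r2 rv1 rv3; rewrite !subseq0 => /eqP->; rewrite ?cats0 => wfr.
  move: (wf_unsign wfr); rewrite /= !unsign_cat /= negbK => wfr'.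
  have /= H := @inv_bigon _ _ inv r p (~~ b) false; rewrite negbK in H; apply: H => //.
  rewrite !size_cat /= !(addnS, addSn) !ltnS leqW //.
  by apply: leq_trans l13; apply: leq_add; apply: sub (leqnn _).
Qed.

Definition relabel f (e : dendpt) : dendpt := (f e.1.1, e.1.2, e.2).

Lemma state_sum_relabel f h h' w : injective f ->
  (forall r, subseq r w -> cval (map (relabel f) r) = cval r) ->
  (forall r, subseq r w -> h (map (relabel f) r) = h' r) ->
  state_sum iota g h (map (relabel f) w) = state_sum iota g h' w.
Proof.
move=> f_inj; have F_inj : injective (relabel f).
  by move=> [[p b] s] [[p' b'] s'] [/f_inj-> -> ->].
have bF e : bar (relabel f e) = relabel f (bar e) by [].
elim/word_ind: w h h' => [|c w cw IH|c x y cx IHx IHy IH] h h' eqC eqh.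
- by rewrite /= !state_sum_nil -eqh.
- rewrite /= !state_sum_solo ?bF ?mem_map //.
  apply: IH => r rw; last by rewrite -eqh //= eqxx.
  by apply: eqC; apply: subseq_trans rw (subseq_cons _ _).
- have sy : subseq y (c :: x ++ bar c :: y).
    by rewrite -cat_cons -cat_rcons suffix_subseq.
  have sx : subseq x (c :: x ++ bar c :: y).
    by rewrite -cat_cons; apply: subseq_trans (subseq_cons _ _) (prefix_subseq _ _).
  rewrite /= map_cat /= -bF !state_sum_pair ?bF ?mem_map //.
  rewrite (_ : weight_of iota (relabel f c) = weight_of iota c) //.
  congr (_ + _ *: (weight_of _ _ _ * _)).
  + move: (IH (fun r => h (relabel f c :: r)) (fun r => h' (c :: r))); rewrite map_cat /=; apply.
      by move=> r rw; apply: eqC; apply: subseq_trans rw (subseq_cons _ _).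
    by move=> r rw; rewrite -eqh //= eqxx.
  + by apply: (IHx cval cval) => r rx; apply: eqC; apply: subseq_trans rx sx.
  + by apply: IHy => r ry; [apply: eqC | apply: eqh]; apply: subseq_trans ry sy.
Qed.

Lemma closed_sum_relabel f w : injective f ->
  (forall r, subseq r w ->
     g [seq (f e.1, e.2) | e <- unsign (dkeep r)] = g (unsign (dkeep r))) ->
  csum (map (relabel f) w) = csum w.
Proof.
move=> f_inj eqg; have F_inj : injective (relabel f).
  by move=> [[p b] s] [[p' b'] s'] [/f_inj-> -> ->].
have eqC r : subseq r w -> cval (map (relabel f) r) = cval r.
  move=> rw; rewrite /component -/(unsign (dkeep r)) -eqg //; congr g.
  rewrite /dkeep filter_map -!map_comp; congr map; apply: eq_filter => e /=.
  by rewrite -(mem_map F_inj r (bar e)).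
by congr integral; apply: state_sum_relabel.
Qed.

End Invariance.

(** * Functoriality and the top state *)

Section Naturality.

Variables (A A' : comNzRingType) (iota : {rmorphism {poly rat} -> A}).
Variables (iota' : {rmorphism {poly rat} -> A'}) (phi : {rmorphism A -> A'}).
Hypothesis phi_iota : forall c, phi (iota c) = iota' c.

Lemma primitive_morph f : map_poly phi (primitive iota f) = primitive iota' (map_poly phi f).
Proof.
apply/polyP => i.
by rewrite coef_map /= !coef_primitive coef_map /= rmorphM /= phi_iota.
Qed.

Lemma integral_morph f : phi (integral iota f) = integral iota' (map_poly phi f).
Proof.
by rewrite /integral -(rmorph1 phi) -horner_map -primitive_morph.
Qed.

Lemma weight_of_morph c f : map_poly phi (weight_of iota c f) = weight_of iota' c (map_poly phi f).
Proof.
rewrite /weight_of /weight map_polyZ rmorphXn rmorphN1 rmorphB /= map_polyC primitive_morph /=.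
by case: ifP => _; rewrite ?integral_morph ?rmorph0.
Qed.

(** The state sum is a polynomial in the values of [g] and [h] with coefficients from [iota]. So
    [nabla] and [psi] can be applied inside it, and [phi = idfun] gives extensionality. *)
Lemma state_sum_morph (g : seq sendpt -> A) (g' : seq sendpt -> A') h h' w :
  (forall r, subseq r w -> phi (component g r) = component g' r) ->
  (forall r, subseq r w -> phi (h r) = h' r) ->
  map_poly phi (state_sum iota g h w) = state_sum iota' g' h' w.
Proof.
elim/word_ind: w h h' => [|c w cw IH|c x y cx IHx IHy IH] h h' eqC eqh.
- by rewrite !state_sum_nil map_polyC /= eqh.
- rewrite !state_sum_solo //; apply: IH => r rw; last by rewrite -eqh //= eqxx.
  by apply: eqC; apply: subseq_trans rw (subseq_cons _ _).
- have sy : subseq y (c :: x ++ bar c :: y).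
    by rewrite -cat_cons -cat_rcons suffix_subseq.
  have sx : subseq x (c :: x ++ bar c :: y).
    by rewrite -cat_cons; apply: subseq_trans (subseq_cons _ _) (prefix_subseq _ _).
  rewrite !state_sum_pair // rmorphD /= map_polyZ /= phi_iota rmorphM /= weight_of_morph.
  rewrite /rooted (IHx _ (component g')) ?(IHy h h') ?(IH _ (fun r => h' (c :: r))) // => r rr;
    first [ by apply: eqC; apply: subseq_trans rr (subseq_cons _ _)
          | by rewrite -eqh //= eqxx
          | by apply: eqC; apply: subseq_trans rr sx
          | by apply: eqC; apply: subseq_trans rr sy
          | by apply: eqh; apply: subseq_trans rr sy ].
Qed.

Lemma closed_sum_morph (g : seq sendpt -> A) (g' : seq sendpt -> A') w :
  (forall u, (size u <= size w)%N -> phi (g u) = g' u) ->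
  phi (closed_sum iota g w) = closed_sum iota' g' w.
Proof.
move=> eqg; have eqC r : subseq r w -> phi (component g r) = component g' r.
  move=> rw; apply: eqg; rewrite size_map; apply: leq_trans (size_subseq rw).
  exact: size_subseq (filter_subseq _ _).
by rewrite /closed_sum integral_morph; congr integral; apply: state_sum_morph.
Qed.

Lemma closed_sum_morph_wf (g : seq sendpt -> A) (g' : seq sendpt -> A') w : wf_diag w ->
  (forall u, wf_str u -> (size u <= size w)%N -> phi (g u) = g' u) ->
  phi (closed_sum iota g w) = closed_sum iota' g' w.
Proof.
move=> wf eqg; have eqC r : subseq r w -> phi (component g r) = component g' r.
  move=> rw; apply: eqg.
    apply: wf_unsign; apply: wf_dkeep; apply: subseq_uniq (wf_diag_uniq wf).
    exact: map_subseq.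
  rewrite size_map; apply: leq_trans (size_subseq rw).
  exact: size_subseq (filter_subseq _ _).
by rewrite /closed_sum integral_morph; congr integral; apply: state_sum_morph.
Qed.

End Naturality.

Section Top.

Variables (A : comNzRingType) (iota : {rmorphism {poly rat} -> A}).
Implicit Types (g : seq sendpt -> A).

Lemma eq_closed_sum g g' w : (forall u, (size u <= size w)%N -> g u = g' u) ->
  closed_sum iota g w = closed_sum iota g' w.
Proof. by move=> eqg; apply: (@closed_sum_morph _ _ iota iota idfun). Qed.

Lemma state_sum_top g g' h h' w :
  (forall r, subseq r w -> (size r < size w)%N -> component g r = component g' r) ->
  (forall r, subseq r w -> (size r < size w)%N -> h r = h' r) ->
  state_sum iota g h w = state_sum iota g' h' w + (h w - h' w)%:P.
Proof.
have eqS g1 g2 h1 h2 v : (forall r, subseq r v -> component g1 r = component g2 r) ->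
    (forall r, subseq r v -> h1 r = h2 r) -> state_sum iota g1 h1 v = state_sum iota g2 h2 v.
  move=> eqC eqh; rewrite -[LHS](map_poly_id (g := idfun)) //.
  exact: (@state_sum_morph _ _ iota iota idfun).
elim/word_ind: w h h' => [|c w cw IH|c x y cx _ _ IH] h h' eqC eqh.
- by rewrite !state_sum_nil -polyCD addrC subrK.
- rewrite !state_sum_solo // (IH _ (fun r => h' (c :: r))) // => r rw sz.
    by apply: eqC; [apply: subseq_trans rw (subseq_cons _ _) | apply: ltnW].
  by apply: eqh; rewrite /= ?eqxx.
- have [sy lty] : subseq y (c :: x ++ bar c :: y) /\ (size y < size (c :: x ++ bar c :: y))%N.
    by rewrite -cat_cons -cat_rcons suffix_subseq /= size_cat size_rcons ltnS !(addSn, addnS) leqW // leq_addl.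
  have [sx ltx] : subseq x (c :: x ++ bar c :: y) /\ (size x < size (c :: x ++ bar c :: y))%N.
    rewrite -cat_cons /= size_cat ltnS leq_addr; split=> //.
    by apply: subseq_trans (subseq_cons _ _) (prefix_subseq (c :: x) _).
  rewrite !state_sum_pair // (IH _ (fun r => h' (c :: r))) //.
  + rewrite -[in LHS]addrA [_%:P + _]addrC !addrA; congr (_ + _ + _).
    rewrite /rooted (eqS _ g' (component g) (component g') x) ?(eqS _ g' h h' y) // => r rr;
      first [ by apply: eqC; [apply: subseq_trans rr sx | apply: leq_ltn_trans (size_subseq rr) ltx]
            | by apply: eqC; [apply: subseq_trans rr sy | apply: leq_ltn_trans (size_subseq rr) lty]
            | by apply: eqh; [apply: subseq_trans rr sy | apply: leq_ltn_trans (size_subseq rr) lty] ].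
  + move=> r rw sz; apply: eqC; [apply: subseq_trans rw (subseq_cons _ _) | exact: ltnW].
  + by move=> r rw sz; apply: eqh; rewrite /= ?eqxx.
Qed.

(* Only the state without smoothings sees the values of [g] in top degree. *)
Lemma closed_sum_top g g' w : wf_diag w ->
  (forall u, (size u < size w)%N -> g u = g' u) ->
  closed_sum iota g w = closed_sum iota g' w + (g (unsign w) - g' (unsign w)).
Proof.
move=> wf eqg.
have eqC r : subseq r w -> (size r < size w)%N -> component g r = component g' r.
  move=> rw sz; apply: eqg; rewrite size_map; apply: leq_ltn_trans sz.
  exact: size_subseq (filter_subseq _ _).
rewrite /closed_sum /rooted (state_sum_top (g' := g') (h' := component g')) //.
by rewrite linearD /= integralC /component dkeep_id.
Qed.

End Top.

Lemma wf_diag_pair p b s v :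
  wf_diag [:: (p, b, s), (p, ~~ b, s) & v] = avoids [:: p] v && wf_diag v.
Proof.
apply/idP/andP => [wf|[av]].
  have [_ av] := @avoids_wf p b s [::] v _ (wf_diag_uniq wf) (perm_refl _).
  split=> //; case/andP: wf => /= /and3P[_ _ uv] /and3P[_ _ /allP cv].
  apply/andP; split=> //; apply/allP => e ev; have := cv e ev; rewrite !inE.
  have /negPf np : e.1.1 != p by have := allP av e ev; rewrite inE.
  by rewrite !xpair_eqE /= np.
case/andP => uv /allP cv; have npv b' : (p, b') \notin [seq e.1 | e <- v].
  apply/negP => /mapP[e ev /(congr1 fst) /= Ep]; have := allP av e ev.
  by rewrite !inE -Ep eqxx.
apply/andP; split.
  by rewrite /= !inE negb_or !npv uv !andbT xpair_eqE; case: (b); rewrite andbF.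
rewrite /= !inE negbK !eqxx ?orbT /=; apply/allP => e ev.
by rewrite !inE (cv _ ev) !orbT.
Qed.

Definition lift_signs (s : nat -> bool) (w : seq sendpt) : seq dendpt :=
  [seq (e, s e.1) | e <- w].

Lemma lift_signs_cat s v w : lift_signs s (v ++ w) = lift_signs s v ++ lift_signs s w.
Proof. exact: map_cat. Qed.

Lemma lift_signsK s w : unsign (lift_signs s w) = w.
Proof. by rewrite /unsign -map_comp map_id. Qed.

Lemma wf_lift_signs s w : wf_diag (lift_signs s w) = wf_str w.
Proof.
apply/idP/idP => [/wf_unsign|/andP[uw /allP cw]]; first by rewrite lift_signsK.
rewrite /wf_diag -/(unsign _) lift_signsK uw /=; apply/allP => _ /mapP[e ew ->] /=.
by apply/mapP; exists (e.1, ~~ e.2); rewrite ?cw.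
Qed.

Lemma wf_str_pair p b v :
  wf_str [:: (p, b), (p, ~~ b) & v] = avoids [:: p] (lift_signs xpredT v) && wf_str v.
Proof. by rewrite -(wf_lift_signs xpredT) /= wf_diag_pair wf_lift_signs. Qed.

Lemma fresh_label (w : seq dendpt) : exists q, avoids [:: q] w.
Proof.
exists (\max_(e <- w) e.1.1).+1; apply/allP => e ew; rewrite inE ltn_eqF // ltnS.
exact: leq_bigmax_seq.
Qed.

Lemma diag_eqrelP x y : diag_eqrel x y <-> diag_rel x y.
Proof.
rewrite /diag_eqrel; case: (classb_equiv diag_rel_equiv) => r s t /=; exact: classbP.
Qed.

Lemma str_eqrelP x y : str_eqrel x y <-> str_rel x y.
Proof.
rewrite /str_eqrel; case: (classb_equiv str_rel_equiv) => r s t /=; exact: classbP.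
Qed.

Lemma knot_class_step w w' : wf_diag w -> wf_diag w' -> dstep w w' ->
  knot_class w = knot_class w'.
Proof.
move=> wf wf' st; apply/eqquotP/diag_eqrelP.
by rewrite /diag_rel !val_insubd wf wf'; apply: rst_step.
Qed.

Lemma str_class_step w w' : wf_str w -> wf_str w' -> sstep w w' ->
  str_class w = str_class w'.
Proof.
move=> wf wf' st; apply/eqquotP/str_eqrelP.
by rewrite /str_rel !val_insubd wf wf'; apply: rst_step.
Qed.

Lemma knot_class_repr (T : Type) (F : seq dendpt -> T) w :
  (forall u v, wf_diag u -> wf_diag v -> dstep u v -> F u = F v) ->
  wf_diag w -> F (val (repr (knot_class w))) = F w.
Proof.
move=> FP wf; have: repr (knot_class w) = insubd (exist _ [::] wf_diag_nil : adiag) w %[mod Knot].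
  exact: reprK.
move/eqquotP/diag_eqrelP.
rewrite /diag_rel val_insubd wf; move: (val _) => u.
by elim=> {u w wf} [x y [? ? ?]|x|x y _ ->|x y z' _ -> _ ->] //; apply: FP.
Qed.

Lemma str_class_repr (T : Type) (F : seq sendpt -> T) w :
  (forall u v, wf_str u -> wf_str v -> sstep u v -> F u = F v) ->
  wf_str w -> F (val (repr (str_class w))) = F w.
Proof.
move=> FP wf; have: repr (str_class w) = insubd (exist _ [::] wf_str_nil : vstring) w %[mod Str].
  exact: reprK.
move/eqquotP/str_eqrelP.
rewrite /str_rel val_insubd wf; move: (val _) => u.
by elim=> {u w wf} [x y [? ? ?]|x|x y _ ->|x y z' _ -> _ ->] //; apply: FP.
Qed.

(** * Virtual knots and homotopy classes of strings *)

Lemma wf_diag_bigon p q b s (o : bool) v t :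
  let c := (p, b, s) in let d := (q, ~~ b, ~~ s) in
  let x := if o then [:: bar c; bar d] else [:: bar d; bar c] in
  wf_diag (c :: d :: v ++ x ++ t) -> wf_diag (v ++ t).
Proof.
move=> c d x wf; have : wf_diag [:: c, bar c, d, bar d & v ++ t].
  by rewrite -(wf_diag_perm (_ : perm_eq (c :: d :: v ++ x ++ t) _)) // /x; case: (o); counting.
by rewrite wf_diag_pair => /andP[_]; rewrite wf_diag_pair => /andP[].
Qed.

Lemma wf_str_bigon p q b (o : bool) v t :
  let x := if o then [:: (p, ~~ b); (q, b)] else [:: (q, b); (p, ~~ b)] in
  wf_str [:: (p, b), (q, ~~ b) & v ++ x ++ t] -> wf_str (v ++ t).
Proof.
move=> x wf; have : wf_str [:: (p, b), (p, ~~ b), (q, b), (q, ~~ b) & v ++ t].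
  by rewrite -(wf_str_perm (_ : perm_eq [:: (p, b), (q, ~~ b) & v ++ x ++ t] _)) // /x;
    case: (o); counting.
by rewrite wf_str_pair => /andP[_]; rewrite wf_str_pair => /andP[].
Qed.

Lemma knot_class_rot u v : wf_diag (u ++ v) -> knot_class (u ++ v) = knot_class (v ++ u).
Proof.
move=> wf; apply: knot_class_step => //; last exact: dstep_rot.
by rewrite -(wf_diag_perm (_ : perm_eq (u ++ v) _)) // perm_catC.
Qed.

(* For [b = true] the arrow is created next to an auxiliary one by move (b),
   and the auxiliary arrow is removed by move (a). *)
Lemma knot_class_isolated p b s v : wf_diag [:: (p, b, s), (p, ~~ b, s) & v] ->
  knot_class [:: (p, b, s), (p, ~~ b, s) & v] = knot_class v.
Proof.
move=> wf; have := wf; rewrite wf_diag_pair => /andP[av wfv].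
case: b wf => wf; last by apply/esym/knot_class_step => //; exact: (dstep_a [::]).
have [q aq] := fresh_label [:: (p, true, s), (p, false, s) & v].
have wfq : wf_diag [:: (p, true, s), (q, false, ~~ s), (q, true, ~~ s), (p, false, s) & v].
  rewrite -(wf_diag_perm (_ : perm_eq
    [:: (q, false, ~~ s), (q, true, ~~ s), (p, true, s), (p, false, s) & v] _)).
    by rewrite wf_diag_pair aq.
  by counting.
transitivity (knot_class
    [:: (p, true, s), (q, false, ~~ s), (q, true, ~~ s), (p, false, s) & v]).
  apply: knot_class_step => //; exact: (@dstep_a [:: (p, true, s)]).
apply/esym/knot_class_step => //.
by have /= := @dstep_b [::] [::] v q p false true (~~ s); rewrite negbK.
Qed.

Lemma str_class_isolated p b v : wf_str [:: (p, b), (p, ~~ b) & v] ->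
  str_class [:: (p, b), (p, ~~ b) & v] = str_class v.
Proof.
move=> wf; have := wf; rewrite wf_str_pair => /andP[av wfv].
case: b wf => wf; last by apply/esym/str_class_step => //; exact: (sstep_a [::]).
have [q aq] := fresh_label (lift_signs xpredT [:: (p, true), (p, false) & v]).
have wfq : wf_str [:: (p, true), (q, false), (q, true), (p, false) & v].
  rewrite -(wf_str_perm (_ : perm_eq
    [:: (q, false), (q, true), (p, true), (p, false) & v] _)).
    by rewrite wf_str_pair aq.
  by counting.
transitivity (str_class [:: (p, true), (q, false), (q, true), (p, false) & v]).
  apply: str_class_step => //; exact: (@sstep_a [:: (p, true)]).
apply/esym/str_class_step => //.
exact: (@sstep_b [::] [::] v q p false true).
Qed.

Lemma knot_class_bigon p q b s (o : bool) v t :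
  let c := (p, b, s) in let d := (q, ~~ b, ~~ s) in
  let x := if o then [:: bar c; bar d] else [:: bar d; bar c] in
  wf_diag (c :: d :: v ++ x ++ t) ->
  knot_class (c :: d :: v ++ x ++ t) = knot_class (v ++ t).
Proof.
move=> c d x wf; have wf' := wf_diag_bigon wf; apply/esym/knot_class_step => //.
move: @c @d @x {wf wf'}; rewrite /bar /=; case: b; rewrite /= ?negbK.
  (* The head comes first, so the two arrows exchange their roles in move (b), which also reverses
     the order on the second arc. *)
  by have /= := @dstep_b [::] v t q p false (~~ o) (~~ s); rewrite negbK; case: o.
exact: (@dstep_b [::] v t p q true o s).
Qed.

Lemma str_class_bigon p q b (o : bool) v t :
  let x := if o then [:: (p, ~~ b); (q, b)] else [:: (q, b); (p, ~~ b)] in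
  wf_str [:: (p, b), (q, ~~ b) & v ++ x ++ t] ->
  str_class [:: (p, b), (q, ~~ b) & v ++ x ++ t] = str_class (v ++ t).
Proof.
move=> x wf; have wf' := wf_str_bigon wf; apply/esym/str_class_step => //.
move: @x {wf wf'}; case: b => /=.
  by have /= := @sstep_b [::] v t q p false (~~ o); case: o.
exact: (@sstep_b [::] v t p q true o).
Qed.

Lemma knot_class_triangle p q r b v1 v2 v3 :
  let al := (p, ~~ b, ~~ b) in let d := (q, b, true) in let be := (r, b, b) in
  let w := bar be :: bar al :: v1 ++ al :: d :: v2 ++ bar d :: be :: v3 in
  let w' := bar al :: bar be :: v1 ++ d :: al :: v2 ++ be :: bar d :: v3 in
  wf_diag w -> knot_class w = knot_class w' /\ wf_diag w'.
Proof.
move=> al d be w w' wf; have wf' : wf_diag w'.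
  by rewrite -(wf_diag_perm (_ : perm_eq w _)) // /w /w'; counting.
split=> //; move: wf wf'; rewrite /w /w' /al /d /be /bar /=; case: b {w w' al d be} => /= wf wf'.
  (* The other cyclic order of move (c), read backwards with [p] and [r] exchanged. *)
  apply/esym/knot_class_step => //; exact: (@dstep_c2 v1 v2 v3 r q p).
apply: knot_class_step => //; exact: (@dstep_c1 v1 v2 v3 p q r).
Qed.

Lemma str_class_triangle p q r b v1 v2 v3 :
  let w := [:: (r, ~~ b), (p, b) &
     v1 ++ [:: (p, ~~ b), (q, b) & v2 ++ [:: (q, ~~ b), (r, b) & v3]]] in
  let w' := [:: (p, b), (r, ~~ b) &
     v1 ++ [:: (q, b), (p, ~~ b) & v2 ++ [:: (r, b), (q, ~~ b) & v3]]] in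
  wf_str w -> str_class w = str_class w'.
Proof.
move=> w w' wf; have wf' : wf_str w'.
  by rewrite -(wf_str_perm (_ : perm_eq w _)) // /w /w'; counting.
move: wf wf'; rewrite /w /w'; case: b {w w'} => /= wf wf'.
  apply/esym/str_class_step => //; exact: (@sstep_c2 v1 v2 v3 r q p).
apply: str_class_step => //; exact: (@sstep_c1 v1 v2 v3 p q r).
Qed.

Lemma str_class_invariant (A : comNzRingType) (G : Str -> A) N :
  G trivial_string = 0 -> invariant_below (fun w => G (str_class w)) N.
Proof.
move=> G0; split=> //.
- move=> e w wf _; congr G; apply: str_class_step => //; last exact: (sstep_rot [:: e]).
  by rewrite -(wf_str_perm (_ : perm_eq (e :: w) _)) // -cat1s perm_catC.
- by move=> p b w d wf _; rewrite str_class_isolated.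
- by move=> p q b o v w s d wf _; rewrite str_class_bigon.
- by move=> p q r b v1 v2 v3 d wf _; congr G; apply: str_class_triangle.
Qed.

Lemma wf_str_relabel f w : injective f ->
  wf_str [seq (f e.1, e.2) | e <- w] = wf_str w.
Proof.
move=> f_inj; have F_inj : injective (fun e : sendpt => (f e.1, e.2)).
  by move=> [p b] [p' b'] [/f_inj-> ->].
rewrite /wf_str (map_inj_uniq F_inj) all_map; congr (_ && _); apply: eq_all => e /=.
exact: (mem_map F_inj w (e.1, ~~ e.2)).
Qed.

Lemma wf_diag_relabel f w : injective f -> wf_diag (map (relabel f) w) = wf_diag w.
Proof.
move=> f_inj; have F_inj : injective (relabel f).
  by move=> [[p b] s] [[p' b'] s'] [/f_inj-> -> ->].
have G_inj : injective (fun e : sendpt => (f e.1, e.2)).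
  by move=> [p b] [p' b'] [/f_inj-> ->].
rewrite /wf_diag all_map; congr (_ && _).
  by rewrite -(map_inj_uniq G_inj [seq e.1 | e <- w]) -!map_comp.
by apply: eq_all => e /=; exact: (mem_map F_inj w (bar e)).
Qed.

(** * All moves at arbitrary places, for [g] invariant in every length *)

Section Steps.

Variables (A : comNzRingType) (iota : {rmorphism {poly rat} -> A}) (g : seq sendpt -> A).
Hypothesis inv : forall N, invariant_below g N.
Hypothesis inv_relabel : forall f w, injective f -> wf_str w ->
  g [seq (f e.1, e.2) | e <- w] = g w.

Lemma inv_cat u v : wf_str (u ++ v) -> g (u ++ v) = g (v ++ u).
Proof.
elim: u v => [|e u IH] v; first by rewrite cats0.
rewrite cat_cons => wf; rewrite (inv_rot (inv _) wf (ltnSn _)) -catA IH -?catA //.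
by rewrite -(wf_str_perm (_ : perm_eq (e :: u ++ v) _)) // -cat1s perm_catC catA.
Qed.

Lemma inv_sstep u v : wf_str u -> wf_str v -> sstep u v -> g u = g v.
Proof.
have rot x y : wf_str (x ++ y) -> wf_str (y ++ x).
  by rewrite (wf_str_perm (_ : perm_eq (x ++ y) (y ++ x))) // perm_catC.
move=> wfu wfv st; case: st wfu wfv => {u v}.
- by move=> u v wf _; apply: inv_cat.
- by move=> f w f_inj wf _; rewrite inv_relabel.
- move=> u v p wf wf'; rewrite inv_cat // [RHS]inv_cat //; apply/esym.
  have wf2 := rot _ _ wf'; exact: (@inv_isolated _ _ _ (inv _) p false _ wf2 (ltnSn _)).
- move=> u v t p q oX oY a b b' a' wf wf'.
  rewrite inv_cat // [RHS]inv_cat // -!catA; apply/esym.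
  have := rot _ _ wf'; rewrite -!catA {wf wf'}/a {}/b {}/b' {}/a'; case: oX; case: oY => /= wf.
  + exact: (@inv_bigon _ _ _ (inv _) p q false true _ _ wf (ltnSn _)).
  + exact: (@inv_bigon _ _ _ (inv _) p q false false _ _ wf (ltnSn _)).
  + exact: (@inv_bigon _ _ _ (inv _) q p true false _ _ wf (ltnSn _)).
  + exact: (@inv_bigon _ _ _ (inv _) q p true true _ _ wf (ltnSn _)).
- move=> v1 v2 v3 p1 p2 p3 wf wf'.
  exact: (@inv_triangle _ _ _ (inv _) p1 p2 p3 false v1 v2 v3 wf (ltnSn _)).
- move=> v1 v2 v3 p1 p2 p3 wf wf'; apply/esym.
  exact: (@inv_triangle _ _ _ (inv _) p3 p2 p1 true v1 v2 v3 wf' (ltnSn _)).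
Qed.

Local Notation csum := (closed_sum iota g).

Lemma closed_sum_cat u v : wf_diag (u ++ v) -> csum (u ++ v) = csum (v ++ u).
Proof.
elim: u v => [|e u IH] v; first by rewrite cats0.
rewrite cat_cons => wf; rewrite (closed_sum_rot iota wf (inv _)); last first.
  by rewrite unsign_cat; exact: (inv_rot (inv _) (wf_unsign wf) (ltnSn _)).
rewrite -catA IH -?catA //.
by rewrite -(wf_diag_perm (_ : perm_eq (e :: u ++ v) _)) // -cat1s perm_catC catA.
Qed.

Lemma closed_sum_dstep u v : wf_diag u -> wf_diag v -> dstep u v ->
  csum u = csum v.
Proof.
have rot x y : wf_diag (x ++ y) -> wf_diag (y ++ x).
  by rewrite (wf_diag_perm (_ : perm_eq (x ++ y) (y ++ x))) // perm_catC.
have bigon p q b s o x y : 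
  let c := (p, b, s) in let d := (q, ~~ b, ~~ s) in
  let z := if o then [:: bar c; bar d] else [:: bar d; bar c] in
  wf_diag (c :: d :: x ++ z ++ y) -> csum (c :: d :: x ++ z ++ y) = csum (x ++ y).
  move=> c d z wf; apply: (closed_sum_bigon iota wf (inv _)).
  have wfs := wf_unsign wf; move: wfs {wf}; rewrite /z /c /d /bar; case: (o) => /=;
    rewrite /= !unsign_cat /= negbK => wfs.
    exact: (@inv_bigon _ _ _ (inv _) p q b true _ _ wfs (ltnSn _)).
  exact: (@inv_bigon _ _ _ (inv _) p q b false _ _ wfs (ltnSn _)).
have triangle p q r b v1 v2 v3 :
  let al := (p, ~~ b, ~~ b) in let d := (q, b, true) in let be := (r, b, b) in
  let w := bar be :: bar al :: v1 ++ al :: d :: v2 ++ bar d :: be :: v3 in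
  let w' := bar al :: bar be :: v1 ++ d :: al :: v2 ++ be :: bar d :: v3 in
  wf_diag w -> csum w = csum w'.
  move=> al d be w w' wf; apply: (closed_sum_triangle iota wf (inv _)).
  have := wf_unsign wf; rewrite /= !unsign_cat /= !unsign_cat /= !negbK => wfs.
  exact: (@inv_triangle _ _ _ (inv _) p q r b _ _ _ wfs (ltnSn _)).
move=> wfu wfv st; case: st wfu wfv => {u v}.
- by move=> u v wf _; apply: closed_sum_cat.
- move=> f w f_inj wf _; apply/esym/closed_sum_relabel => // r rw; apply: inv_relabel => //.
  apply: wf_unsign; apply: wf_dkeep; apply: subseq_uniq (wf_diag_uniq wf).
  exact: map_subseq.
(* Rotation brings the move to the base point. *)
- move=> u v p s wf wf'; rewrite closed_sum_cat // [RHS]closed_sum_cat //; apply/esym.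
  have wf2 := rot _ _ wf'; apply: (@closed_sum_isolated _ _ _ p false s _ wf2 (inv _)).
  exact: (@inv_isolated _ _ _ (inv _) p false _ (wf_unsign wf2) (ltnSn _)).
- move=> u v t p q oX oY s a b b' a' wf wf'.
  rewrite closed_sum_cat // [RHS]closed_sum_cat // -!catA; apply/esym.
  have := rot _ _ wf'; rewrite -!catA {wf wf'}/a {}/b {}/b' {}/a'; case: oX; case: oY => /= wf.
  + exact: (bigon p q false s true).
  + exact: (bigon p q false s false).
  + by move: wf; have /= := bigon q p true (~~ s) false v (t ++ u); rewrite /bar /= !negbK.
  + by move: wf; have /= := bigon q p true (~~ s) true v (t ++ u); rewrite /bar /= !negbK.
- move=> v1 v2 v3 p1 p2 p3 wf wf'; exact: (triangle p1 p2 p3 false v1 v2 v3 wf).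
- move=> v1 v2 v3 p1 p2 p3 wf wf'; apply/esym.
  exact: (triangle p3 p2 p1 true v1 v2 v3 wf').
Qed.

End Steps.

(** * Inverting the state sum *)

Lemma closed_sum_dkeep (A : comNzRingType) (iota : {rmorphism {poly rat} -> A}) g w :
  closed_sum iota g (dkeep w) = closed_sum iota g w.
Proof.
by congr integral; apply: (@rooted_filter _ iota g (fun e => bar e \in w)).
Qed.

Lemma split_has (T : Type) (a : pred T) w : has a w ->
  exists u e t, [/\ w = u ++ e :: t, a e & all (predC a) u].
Proof.
elim: w => //= e w IH; have [ae _|nae /= /IH [u] [d] [t] [-> ad au]] := boolP (a e).
  by exists [::], e, w.
by exists (e :: u), d, t; rewrite /= nae.
Qed.

Lemma wf_diag_arrow p b s u x y :
  wf_diag (u ++ (p, b, s) :: x ++ (p, ~~ b, s) :: y) =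
  avoids [:: p] (x ++ y ++ u) && wf_diag (x ++ y ++ u).
Proof.
by rewrite -(wf_diag_pair p b s); apply: wf_diag_perm; counting.
Qed.

Section Truncation.

Variables (A : comNzRingType) (iota : {rmorphism {poly rat} -> A}) (K : seq dendpt -> A).

(** Values in top length are not yet known to be invariant during the induction; the free value [a]
    takes their place. *)
Definition truncate (n : nat) (g : seq sendpt -> A) (a : A) u :=
  if (size u < n)%N then g u else a.

(** Truncation at [size w] with value 0 deletes the state without smoothings, so this solves the
    expansion for the value on [w]. The all-positive lift is one choice of signs; [expandsS] shows
    that every other choice gives the same value in the skein algebra. *)
Fixpoint inverted_rec n (w : seq sendpt) : A :=
  if n is n'.+1 then
    K (lift_signs xpredT w) -
    closed_sum iota (truncate (size w) (inverted_rec n') 0) (lift_signs xpredT w)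
  else 0.

Definition inverted w := inverted_rec (size w).+1 w.

Lemma inverted_rec_fuel n m w : (size w < n)%N -> (size w < m)%N ->
  inverted_rec n w = inverted_rec m w.
Proof.
elim: n m w => [|n IH] [|m] w //= len lem.
congr (_ - _); apply: eq_closed_sum => u _; rewrite /truncate; case: ifP => // lt.
by apply: IH; apply: leq_trans lt _.
Qed.

Lemma invertedE w : inverted w = K (lift_signs xpredT w) -
  closed_sum iota (truncate (size w) inverted 0) (lift_signs xpredT w).
Proof.
rewrite {1}/inverted /=; congr (_ - _); apply: eq_closed_sum => u _.
by rewrite /truncate; case: ifP => // lt; apply: inverted_rec_fuel.
Qed.

End Truncation.

(* The recursive definition of [sigma] below inverts the expansion of [K] as a
   [closed_sum]: its top state is [sigma] of the whole string. *)
Section Inversion.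

Variables (A : comNzRingType) (iota : {rmorphism {poly rat} -> A}).
Variables (K : seq dendpt -> A) (sigma : seq sendpt -> A).

Hypothesis K_nil : K [::] = 0.
Hypothesis K_rot : forall c w, wf_diag (c :: w) -> K (c :: w) = K (w ++ [:: c]).
Hypothesis K_isolated : forall p b s v, wf_diag [:: (p, b, s), (p, ~~ b, s) & v] ->
  K [:: (p, b, s), (p, ~~ b, s) & v] = K v.
Hypothesis K_bigon : forall p q b s (o : bool) v t,
  let c := (p, b, s) in let d := (q, ~~ b, ~~ s) in
  let x := if o then [:: bar c; bar d] else [:: bar d; bar c] in
  wf_diag (c :: d :: v ++ x ++ t) -> K (c :: d :: v ++ x ++ t) = K (v ++ t).
Hypothesis K_triangle : forall p q r b v1 v2 v3,
  let al := (p, ~~ b, ~~ b) in let d := (q, b, true) in let be := (r, b, b) in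
  let w := bar be :: bar al :: v1 ++ al :: d :: v2 ++ bar d :: be :: v3 in
  let w' := bar al :: bar be :: v1 ++ d :: al :: v2 ++ be :: bar d :: v3 in
  wf_diag w -> K w = K w'.
Hypothesis K_relabel : forall f w, injective f -> wf_diag w -> K (map (relabel f) w) = K w.
Hypothesis K_skein : forall p b u x y,
  wf_diag (u ++ (p, b, true) :: x ++ (p, ~~ b, true) :: y) ->
  K (u ++ (p, b, true) :: x ++ (p, ~~ b, true) :: y) -
  K (u ++ (p, b, false) :: x ++ (p, ~~ b, false) :: y) =
    iota 'X * (K (dkeep x) * K (dkeep (y ++ u))).
Hypothesis sigmaE : forall w, sigma w =
  K (lift_signs xpredT w) -
  closed_sum iota (truncate (size w) sigma 0) (lift_signs xpredT w).

Local Notation csum := (closed_sum iota).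

Lemma eq_invariant_below (g g' : seq sendpt -> A) N : g [::] = g' [::] ->
  (forall u, (size u < N)%N -> g u = g' u) -> invariant_below g N -> invariant_below g' N.
Proof.
move=> eq0 eqg [h0 h1 h2 h3 h4]; split.
- by rewrite -eq0.
- move=> e w wf sz; rewrite -!eqg // ?h1 //; by rewrite size_cat addn1.
- by move=> p b w d wf sz; rewrite -!eqg // ?h2 //; apply: leq_trans sz; rewrite /= ltnS ltnW.
- move=> p q b o v w s d wf sz; rewrite -!eqg // ?h3 //; apply: leq_trans sz.
  by rewrite /d /s /= !size_cat; case: (o) => /=; rewrite !addnS ltnS !leqW.
- move=> p q r b v1 v2 v3 d wf sz; rewrite -!eqg ?h4 //; apply: leq_trans sz.
  by rewrite /d /= !size_cat /= !size_cat.
Qed.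

Lemma closed_sum_truncate w a : wf_diag w ->
  csum sigma w = csum (truncate (size w) sigma a) w + (sigma (unsign w) - a).
Proof.
move=> wf; rewrite (closed_sum_top iota wf (g' := truncate (size w) sigma a)).
  by rewrite [in truncate _ _ _ (unsign w)]/truncate size_map ltnn.
by move=> u sz; rewrite /truncate sz.
Qed.

Lemma truncate_below N a : (0 < N)%N -> invariant_below sigma N ->
  invariant_below (truncate N sigma a) N.
Proof.
move=> N0; apply: eq_invariant_below; first by rewrite /truncate N0.
by move=> v sv; rewrite /truncate sv.
Qed.

Lemma truncate_top N a u : size u = N -> truncate N sigma a u = a.
Proof. by move=> <-; rewrite /truncate ltnn. Qed.

(** In length [N] the truncated evaluation is constant, so its equation for the full word is trivial
    and no rotation invariance of [sigma] in that length enters. *)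
Lemma closed_sum_cat_below N u v : wf_diag (u ++ v) -> size (u ++ v) = N ->
  invariant_below (truncate N sigma 0) N ->
  csum (truncate N sigma 0) (u ++ v) = csum (truncate N sigma 0) (v ++ u).
Proof.
elim: u v => [|e u IH] v; first by rewrite cats0.
rewrite cat_cons => wf sz inv; rewrite (closed_sum_rot iota wf); first 1 last.
- by rewrite sz.
- by rewrite !truncate_top // size_map // size_cat addn1.
rewrite -catA IH -?catA //; last by rewrite -sz /= !size_cat /= addnA addn1.
by rewrite -(wf_diag_perm (_ : perm_eq (e :: u ++ v) _)) // -cat1s perm_catC catA.
Qed.

Definition expands N := forall w, wf_diag w -> (size w < N)%N -> csum sigma w = K w.

Definition relabels N := forall f w, injective f -> wf_str w -> (size w < N)%N ->
  sigma [seq (f e.1, e.2) | e <- w] = sigma w.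

(** For all-positive diagrams this is the definition of [sigma]. Making a negative arrow positive
    changes both sides by the same skein term, which only involves shorter diagrams, and leaves the
    top value [sigma (unsign w)] alone. Hence an induction on the number of negative endpoints. *)
Lemma expandsS N : invariant_below sigma N -> expands N -> expands N.+1.
Proof.
move=> inv expN w wf; rewrite ltnS leq_eqVlt => /orP[/eqP sz|]; last exact: expN.
have [n] := ubnP (count (fun e : dendpt => ~~ e.2) w); elim: n w wf sz => // n IH w wf sz.
rewrite ltnS => le; have [/allP pos|] := boolP (all snd w).
  rewrite (closed_sum_truncate 0) // subr0.
  have {2}-> : w = lift_signs xpredT (unsign w).
    rewrite /lift_signs /unsign -map_comp -[LHS]map_id; apply/eq_in_map => -[e s] /pos /= ->.
    by [].
  rewrite sigmaE size_map.
  have -> : lift_signs xpredT (unsign w) = w.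
    rewrite /lift_signs /unsign -map_comp -[RHS]map_id; apply/eq_in_map => -[e s] /pos /= ->.
    by [].
  by rewrite addrC subrK.
rewrite -has_predC => /split_has [u] [[[p b] s]] [t] [Dw /negPf /= Ds /allP posu]; subst s w.
have bt : (p, ~~ b, false) \in t.
  case/andP: wf => _ /allP /(_ (p, b, false)); rewrite !mem_cat mem_head orbT => /(_ isT).
  rewrite inE !xpair_eqE; case: (b) => /=; rewrite ?andbF ?orbF;
    by case/orP => // /posu.
have [x [y [Dt bx]]] := split_first bt; subst t.
have wfp : wf_diag (u ++ (p, b, true) :: x ++ (p, ~~ b, true) :: y).
  by move: wf; rewrite !wf_diag_arrow.
have /andP[axyu wfxyu] : avoids [:: p] (x ++ y ++ u) && wf_diag (x ++ y ++ u).
  by rewrite -(wf_diag_arrow p b true).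
have [ax ayu] : avoids [:: p] x /\ avoids [:: p] (y ++ u).
  by apply/andP; rewrite -avoids_cat.
have szE s' : size (u ++ (p, b, s') :: x ++ (p, ~~ b, s') :: y) = N.
  by rewrite -sz !size_cat /= !size_cat.
have lt_x : (size x < N)%N.
  by rewrite -sz !size_cat /= size_cat /= !addnS ltnS leqW // addnCA leq_addr.
have lt_yu : (size (y ++ u) < N)%N.
  by rewrite -sz !size_cat /= size_cat /= !addnS ltnS leqW // (addnC (size y)) leq_add2l leq_addl.
have N0 : (0 < N)%N by apply: leq_trans lt_x.
have inv0 := truncate_below 0 N0 inv.
have eq_small v : (size v < N)%N -> csum (truncate N sigma 0) v = csum sigma v.
  by move=> sv; apply: eq_closed_sum => r sr; rewrite /truncate (leq_ltn_trans sr sv).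
(* The skein relation for the state sum is based at the arrow. Splitting off the top value first
   allows the rotation that gets there. *)
have step s' : csum sigma (u ++ (p, b, s') :: x ++ (p, ~~ b, s') :: y) =
    csum (truncate N sigma 0) ((p, b, s') :: x ++ (p, ~~ b, s') :: (y ++ u))
    + sigma (unsign (u ++ (p, b, s') :: x ++ (p, ~~ b, s') :: y)).
  have wfs : wf_diag (u ++ (p, b, s') :: x ++ (p, ~~ b, s') :: y).
    by move: wfp; rewrite !wf_diag_arrow.
  rewrite (closed_sum_truncate 0) // subr0 szE closed_sum_cat_below ?szE //.
  by rewrite /= -catA.
have kept v : wf_diag (dkeep v) -> (size v < N)%N -> csum sigma v = K (dkeep v).
  move=> wfv sv; rewrite -closed_sum_dkeep expN //.
  exact: leq_ltn_trans (size_subseq (filter_subseq _ _)) sv.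
have wf_part v : subseq v (x ++ y ++ u) -> wf_diag (dkeep v).
  move=> sv; apply: wf_dkeep; apply: subseq_uniq (wf_diag_uniq wfxyu); exact: map_subseq.
have := K_skein wfp; rewrite -(IH _ wfp (szE _)); last first.
  apply: leq_trans le; rewrite !count_cat /= !count_cat /=.
  by rewrite !add0n !(addSn, addnS) !add0n ltnS leqW.
rewrite -kept ?wf_part ?prefix_subseq // -kept ?wf_part ?suffix_subseq //.
have sk := closed_sum_skein iota (truncate N sigma 0) b ax ayu.
rewrite -(eq_small _ lt_x) -(eq_small _ lt_yu) -sk !step !unsign_cat /= !unsign_cat /=.
move: (K _) => k; move: (closed_sum _ _ _) (closed_sum _ _ _) (sigma _) => tm tp si eqk.
have -> : k = tp + si - (tp + si - k) by ring.
by rewrite eqk; ring.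
Qed.

(** As the expansion holds for all signs, [sigma] in top length can be computed from whichever lift
    [w] of the string admits the desired move of diagrams, and with any [a]. *)
Lemma sigma_key N w a : expands N.+1 -> wf_diag w -> size w = N ->
  sigma (unsign w) = K w - csum (truncate N sigma a) w + a.
Proof.
move=> expN wf sz; rewrite -expN ?sz // (closed_sum_truncate a) // sz; ring.
Qed.

Lemma relabelsS N : expands N.+1 -> relabels N -> relabels N.+1.
Proof.
move=> expN relN f w f_inj wf; rewrite ltnS leq_eqVlt => /orP[/eqP sz|]; last exact: relN.
have wfl : wf_diag (lift_signs xpredT w) by rewrite wf_lift_signs.
have lift_map : lift_signs xpredT [seq (f e.1, e.2) | e <- w] =
    map (relabel f) (lift_signs xpredT w).
  by rewrite /lift_signs -!map_comp.
rewrite -(lift_signsK xpredT [seq _ | _ <- w]) -{2}(lift_signsK xpredT w).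
rewrite !(@sigma_key N _ 0 expN) ?size_map ?wf_lift_signs ?wf_str_relabel //.
rewrite lift_map K_relabel // closed_sum_relabel // => r rw.
rewrite /truncate size_map; case: ifP => // szr; apply: relN => //.
apply: wf_unsign; apply: wf_dkeep; apply: subseq_uniq (wf_diag_uniq wfl).
exact: map_subseq.
Qed.

(** By [sigma_key], each equation follows from the invariance of [K] and of the truncated state sum.
    Rotation and move (c) preserve the length, so [a = 0] serves. *)
Lemma invariant_belowS N : expands N.+1 -> invariant_below sigma N ->
  invariant_below sigma N.+1.
Proof.
move=> expN inv.
have expand_small v a : wf_diag v -> (size v < N)%N ->
    csum (truncate N sigma a) v = K v.
  move=> wf sv; rewrite -expN ?ltnS ?(ltnW sv) //; apply: eq_closed_sum => u su.
  by rewrite /truncate (leq_ltn_trans su sv).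
have key := @sigma_key N _ _ expN.
split.
- exact: inv_nil inv.
- move=> e w wf; rewrite ltnS leq_eqVlt => /orP[/eqP sz|]; last exact: (inv_rot inv wf).
  have wfl : wf_diag (lift_signs xpredT (e :: w)) by rewrite wf_lift_signs.
  have wfr : wf_diag (lift_signs xpredT (w ++ [:: e])).
    by rewrite wf_lift_signs -(wf_str_perm (_ : perm_eq (e :: w) _)) // -cat1s perm_catC.
  rewrite -(lift_signsK xpredT (e :: w)) -(lift_signsK xpredT (w ++ _)).
  rewrite !(key _ 0) ?size_map // ?size_cat ?addn1 //.
  rewrite lift_signs_cat /= K_rot //.
  have N0 : (0 < N)%N by rewrite -sz.
  by rewrite (@closed_sum_cat_below N [:: _]) /= ?size_map //; apply: truncate_below.
- move=> p b w d wf; rewrite ltnS leq_eqVlt => /orP[/eqP sz|]; last exact: (@inv_isolated _ _ _ inv p b w wf).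
  have wfl : wf_diag (lift_signs xpredT d) by rewrite wf_lift_signs.
  have [_ wfw] : avoids [:: p] (lift_signs xpredT w) /\ wf_diag (lift_signs xpredT w).
    by move: wfl; rewrite /= wf_diag_pair => /andP[].
  (* With [a] the value on the shorter word, the truncated evaluation satisfies the move in top
     length too. *)
  rewrite -(lift_signsK xpredT d) (key _ (sigma w)) ?size_map //.
  have N0 : (0 < N)%N by rewrite -sz.
  have inv0 := truncate_below (sigma w) N0 inv.
  rewrite (@closed_sum_isolated _ iota _ p b true (lift_signs xpredT w)) //; first 1 last.
  + by rewrite /= size_map -[(size w).+2]/(size d) sz.
  + have tw : truncate N sigma (sigma w) w = sigma w by rewrite /truncate; case: ifP.
    rewrite -[unsign (_ :: _)]/(unsign (lift_signs xpredT d)) !lift_signsK tw.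
    exact: truncate_top.
  rewrite expand_small // ?size_map -?sz // K_isolated // subrr add0r //.
- move=> p q b o v w x d wf; rewrite ltnS leq_eqVlt => /orP[/eqP sz|]; last exact: (@inv_bigon _ _ _ inv p q b o v w wf).
  pose V := lift_signs xpredT v; pose W := lift_signs xpredT w.
  (* Opposite signs on the two arrows make this a move (b) of diagrams. *)
  pose c' := (p, b, true) : dendpt; pose d' := (q, ~~ b, false) : dendpt.
  pose x' := if o then [:: bar c'; bar d'] else [:: bar d'; bar c'].
  pose D := c' :: d' :: V ++ x' ++ W.
  have unD : unsign D = d.
    by rewrite /D /d /x /x'; case: (o); rewrite /= !unsign_cat /= !lift_signsK /= negbK.
  have wfD : wf_diag D.
    have : wf_diag [:: c', bar c', d', bar d' & V ++ W].
      have : wf_str [:: (p, b), (p, ~~ b), (q, ~~ b), (q, ~~ ~~ b) & v ++ w].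
        rewrite -(wf_str_perm (_ : perm_eq d _)) // /d /x; case: (o); counting.
      rewrite !wf_str_pair !wf_diag_pair -lift_signs_cat wf_lift_signs => /and3P[a1 a2 wfvw].
      by rewrite wfvw a2; move: a1; rewrite /avoids /= => ->.
    by rewrite -(wf_diag_perm (_ : perm_eq D _)) // /D /x'; case: (o); counting.
  have wfVW := wf_diag_bigon wfD; have szD : size D = N by rewrite -sz -unD size_map.
  have sVW : size (V ++ W) = size (v ++ w) by rewrite !size_cat !size_map.
  have ltN : (size (v ++ w) < N)%N.
    by rewrite -sz /d /x /= !size_cat; case: (o); rewrite /= !addnS ltnS !leqW.
  have N0 : (0 < N)%N by apply: leq_trans ltN.
  rewrite -unD (key _ (sigma (v ++ w))) // (closed_sum_bigon iota wfD); first 1 last.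
  + by rewrite szD; apply: truncate_below.
  + rewrite truncate_top ?size_map // unsign_cat !lift_signsK /truncate ltN //.
  by rewrite expand_small ?sVW // K_bigon // subrr add0r.
- move=> p q r b v1 v2 v3 d wf; rewrite ltnS leq_eqVlt => /orP[/eqP sz|];
    last exact: (@inv_triangle _ _ _ inv p q r b v1 v2 v3 wf).
  pose V1 := lift_signs xpredT v1; pose V2 := lift_signs xpredT v2.
  pose V3 := lift_signs xpredT v3.
  pose al := (p, ~~ b, ~~ b) : dendpt; pose q' := (q, b, true) : dendpt.
  pose be := (r, b, b) : dendpt.
  pose D := bar be :: bar al :: V1 ++ al :: q' :: V2 ++ bar q' :: be :: V3.
  pose D' := bar al :: bar be :: V1 ++ q' :: al :: V2 ++ be :: bar q' :: V3.
  have unD : unsign D = d.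
    by rewrite /D /d /= !unsign_cat /= !unsign_cat /= !lift_signsK /= negbK.
  set d' := (X in _ = sigma X).
  have unD' : unsign D' = d'.
    by rewrite /D' /d' /= !unsign_cat /= !unsign_cat /= !lift_signsK /= negbK.
  have wfD : wf_diag D.
    have : wf_diag [:: al, bar al, q', bar q', be, bar be & V1 ++ V2 ++ V3].
      have : wf_str [:: (p, ~~ b), (p, ~~ ~~ b), (q, b), (q, ~~ b), (r, b), (r, ~~ b)
          & v1 ++ v2 ++ v3].
        by rewrite -(wf_str_perm (_ : perm_eq d _)) // /d; counting.
      rewrite !wf_str_pair !wf_diag_pair -!lift_signs_cat wf_lift_signs => /and4P[a1 a2 a3 wfv].
      by rewrite wfv a3; move: a1 a2; rewrite /avoids /= => -> ->.
    by rewrite -(wf_diag_perm (_ : perm_eq D _)) // /D; counting.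
  have [_ wfD'] := knot_class_triangle wfD.
  have szD : size D = N by rewrite -sz -unD size_map.
  have szD' : size D' = N by rewrite -szD /D /D' /= !size_cat /= !size_cat.
  have N0 : (0 < N)%N by rewrite -sz.
  rewrite -unD -unD' !(key _ 0) // K_triangle //; congr (_ - _ + _).
  apply: (closed_sum_triangle iota wfD); rewrite ?szD; first exact: truncate_below.
  by rewrite !truncate_top // size_map.
Qed.

(** The statements feed one another: expansion in length [N] uses invariance below [N], and
    invariance in length [N] uses that expansion. *)
Lemma sigma_invariant N : [/\ expands N, relabels N & invariant_below sigma N].
Proof.
elim: N => [|N [expN relN inv]]; last first.
  have expN1 := expandsS inv expN.
  by split=> //; [apply: relabelsS | apply: invariant_belowS].
split=> //; split=> //; rewrite sigmaE /= K_nil sub0r.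
by rewrite /closed_sum /rooted state_sum_nil integralC oppr0.
Qed.

End Inversion.

(** * Evaluation in a polynomial algebra *)

Section Evaluation.

Local Open Scope fset_scope.

Variables (B : comNzRingType) (I : choiceType) (S : comNzRingType).
Variables (f : {rmorphism B -> S}) (phi : I -> S).

Definition eval_monom (m : {cmonom I}) : S := \prod_(i <- finsupp m) phi i ^+ m i.

Lemma eval_monomEw (d : {fset I}) (m : {cmonom I}) : finsupp m `<=` d ->
  eval_monom m = \prod_(i <- d) phi i ^+ m i.
Proof.
move=> le; rewrite /eval_monom (big_fset_incl _ le) // => i _.
by rewrite -cmE_neq0 negbK => /eqP->.
Qed.

Lemma eval_monom_mmorphism : mmorphism eval_monom.
Proof.
split=> [m1 m2|]; last by rewrite /eval_monom mdom1 big_seq_fset0.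
rewrite {1}/eval_monom mdomD (eval_monomEw (fsubsetUl _ (finsupp m2))).
rewrite (eval_monomEw (fsubsetUr (finsupp m1) _)) -big_split /=.
by apply: eq_bigr => i _; rewrite cmM exprD.
Qed.
HB.instance Definition _ := isMultiplicative.Build {cmonom I} S eval_monom eval_monom_mmorphism.

Definition evaluation : {malg B[{cmonom I}]} -> S := mmap f eval_monom.
HB.instance Definition _ := GRing.RMorphism.copy evaluation (mmap f eval_monom).

Lemma evaluationU i : evaluation << ucm i >> = phi i.
Proof.
by rewrite /evaluation mmapU /= rmorph1 mul1r /eval_monom mdomU big_seq_fset1 cmUU expr1.
Qed.

Lemma evaluationZ c p : evaluation (c *: p) = f c * evaluation p.
Proof. exact: mmapZ. Qed.

Lemma evaluationC c : evaluation c%:MP = f c.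
Proof. exact: mmapC. Qed.

End Evaluation.

Lemma malg_rmorph_ext (B : comNzRingType) (I : choiceType) (S : comNzRingType)
    (F G : {rmorphism {malg B[{cmonom I}]} -> S}) :
  (forall c, F c%:MP = G c%:MP) -> (forall i, F << ucm i >> = G << ucm i >>) ->
  forall p, F p = G p.
Proof.
move=> eqC eqU.
have UM (c1 c2 : B) (m1 m2 : {cmonom I}) :
    << c1 * c2 *g mmul m1 m2 >> = << c1 *g m1 >> * << c2 *g m2 >> :> {malg B[{cmonom I}]}.
  by apply/esym; exact: fgmulUU.
have eqM (m : {cmonom I}) : F << m >> = G << m >>.
  have [n] := ubnP (mdeg m); elim: n m => // n IH m; rewrite ltnS => le.
  have [->|] := eqVneq m mone; first by rewrite !rmorph1.
  rewrite -mdeg_eq0 mdegE => nz.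
  have [i im] : exists i, i \in finsupp m.
    have [/eqP m0|[i im]] := fset_0Vmem (finsupp m); last by exists i.
    by move: nz; rewrite (eqP m0) big_seq_fset0.
  have Dm : m = mmul (ucm i) (divcm m (ucm i)).
    apply/eqP/cmP => j; rewrite cmM divcmE cmU; case: eqVneq => [<-|_]; last by rewrite subn0.
    by rewrite subnKC // lt0n cmE_neq0.
  have -> : << m >> = << ucm i >> * << divcm m (ucm i) >> :> {malg B[{cmonom I}]}.
    by rewrite -UM mulr1 -Dm.
  rewrite (rmorphM F).
  rewrite (rmorphM G).
  apply: (f_equal2 *%R (eqU i)); apply: IH; apply: leq_trans le.
  by rewrite [in X in (_ < X)%N]Dm mdegM mdegU.
move=> p; rewrite [p]monalgE (rmorph_sum F) (rmorph_sum G); apply: eq_bigr => m _.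
have -> : << p@_m *g m >> = (p@_m)%:MP * << m >> :> {malg B[{cmonom I}]}.
  by rewrite -UM mulr1 mul1m.
rewrite (rmorphM F) (rmorphM G); exact: (f_equal2 *%R (eqC _) (eqM m)).
Qed.

(** * The isomorphism *)

Definition iotaK : {rmorphism {poly rat} -> RK} := @malgC {cmonom Knot} {poly rat}.
Definition iotaS : {rmorphism {poly rat} -> RS0} := @malgC {cmonom S0} {poly rat}.

(** The trivial class has no variable in [S0]; the value 0 matches the trivial knot being a
    generator of the skein ideal. *)
Definition string_var (s : Str) : RS0 :=
  if insub s is Some s0 then << ucm (s0 : S0) >> else 0.
Definition string_value (w : seq sendpt) : RS0 := string_var (str_class w).

Lemma string_var_trivial : string_var trivial_string = 0.
Proof. by rewrite /string_var insubF ?eqxx. Qed.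

Lemma string_var_val (s : S0) : string_var (val s) = << ucm s >>.
Proof. by rewrite /string_var valK. Qed.

Lemma string_value_invariant N : invariant_below string_value N.
Proof. exact: str_class_invariant string_var_trivial. Qed.

Lemma string_value_relabel f w : injective f -> wf_str w ->
  string_value [seq (f e.1, e.2) | e <- w] = string_value w.
Proof.
move=> f_inj wf; congr string_var; apply/esym/str_class_step => //.
  by rewrite wf_str_relabel.
exact: sstep_relabel.
Qed.

Definition knot_value (k : Knot) : RS0 := closed_sum iotaS string_value (val (repr k)).

Lemma knot_value_class w : wf_diag w ->
  knot_value (knot_class w) = closed_sum iotaS string_value w.
Proof.
apply: knot_class_repr => u v; apply: closed_sum_dstep.
  exact: string_value_invariant.
exact: string_value_relabel.
Qed.

Definition nabla : RK -> RS0 := evaluation iotaS knot_value.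
HB.instance Definition _ := GRing.RMorphism.copy nabla (evaluation iotaS knot_value).

Lemma nabla_scalable : scalable nabla.
Proof. by move=> c p; rewrite /nabla evaluationZ; exact: mul_malgC. Qed.
HB.instance Definition _ := GRing.isScalable.Build R RK RS0 *:%R nabla nabla_scalable.

Lemma nabla_kvar w : wf_diag w ->
  nabla (kvar (knot_class w)) = closed_sum iotaS string_value w.
Proof. by move=> wf; rewrite -knot_value_class //; exact: evaluationU. Qed.

Lemma nabla_kvar_nil : nabla (kvar trivial_knot) = 0.
Proof.
rewrite nabla_kvar // /closed_sum /rooted state_sum_nil integralC.
exact: string_var_trivial.
Qed.

Lemma wf_dkeep_arrow p b s u x y :
  wf_diag (u ++ (p, b, s) :: x ++ (p, ~~ b, s) :: y) ->
  wf_diag (dkeep x) /\ wf_diag (dkeep (y ++ u)).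
Proof.
rewrite wf_diag_arrow => /andP[_ /wf_diag_uniq uw].
by split; apply: wf_dkeep; apply: subseq_uniq uw; apply: map_subseq;
  rewrite ?prefix_subseq ?suffix_subseq.
Qed.

Lemma string_closed_sum_skein p b u x y :
  wf_diag (u ++ (p, b, true) :: x ++ (p, ~~ b, true) :: y) ->
  closed_sum iotaS string_value (u ++ (p, b, true) :: x ++ (p, ~~ b, true) :: y) -
  closed_sum iotaS string_value (u ++ (p, b, false) :: x ++ (p, ~~ b, false) :: y) =
    iotaS 'X * (closed_sum iotaS string_value (dkeep x)
                * closed_sum iotaS string_value (dkeep (y ++ u))).
Proof.
move=> wf; have wf' : wf_diag (u ++ (p, b, false) :: x ++ (p, ~~ b, false) :: y).
  by move: wf; rewrite !wf_diag_arrow.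
have /andP[] : avoids [:: p] x && avoids [:: p] (y ++ u).
  by move: wf; rewrite wf_diag_arrow !avoids_cat => /andP[].
move=> ax ayu; rewrite !closed_sum_dkeep -(closed_sum_skein _ _ b ax ayu).
have inv := string_value_invariant.
by rewrite (closed_sum_cat iotaS inv wf) (closed_sum_cat iotaS inv wf') /= -!catA.
Qed.

Lemma nabla_skein_combination a b c d a' b' c' d' :
  nabla a = a' -> nabla b = b' -> nabla c = c' -> nabla d = d' ->
  a' - b' = iotaS 'X * (c' * d') -> nabla (a - b - z *: (c * d)) = 0.
Proof.
move=> <- <- <- <- eqab; rewrite !rmorphB /= nabla_scalable rmorphM /= eqab.
by apply/eqP; rewrite subr_eq0; apply/eqP; exact: mul_malgC.
Qed.

Lemma nabla_skein_gen g : skein_gen g -> nabla g = 0.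
Proof.
case=> [->|[u [x [y [p [tf [wf ->]]]]]]]; first exact: nabla_kvar_nil.
rewrite /skein_elt; case: tf wf => wf.
- have [wf1 wf2] := wf_dkeep_arrow wf.
  have wf' : wf_diag (u ++ (p, false, false) :: x ++ (p, true, false) :: y).
    by move: wf; rewrite !(wf_diag_arrow p false).
  exact: (nabla_skein_combination (nabla_kvar wf) (nabla_kvar wf') (nabla_kvar wf1)
    (nabla_kvar wf2) (string_closed_sum_skein wf)).
- have [wf1 wf2] := wf_dkeep_arrow wf.
  have wf' : wf_diag (u ++ (p, true, false) :: x ++ (p, false, false) :: y).
    by move: wf; rewrite !(wf_diag_arrow p true).
  apply: (nabla_skein_combination (nabla_kvar wf) (nabla_kvar wf') (nabla_kvar wf2)
    (nabla_kvar wf1)).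
  (* With the head first, [x] lies on the arc [ba], so the two factors are exchanged. *)
  by rewrite (string_closed_sum_skein wf) [X in _ * X = _]mulrC.
Qed.

Lemma nabla_skein_ideal p : skein_ideal p -> nabla p = 0.
Proof.
case=> s [gen ->]; rewrite rmorph_sum big_seq big1 // => c /gen /nabla_skein_gen c0.
by rewrite rmorphM /= c0 mulr0.
Qed.

(** * Surjectivity of [nabla] *)

Definition string_lift : seq sendpt -> RK :=
  inverted iotaK (fun D => kvar (knot_class D)).

Lemma string_liftE w : string_lift w = kvar (knot_class (lift_signs xpredT w)) -
  closed_sum iotaK (truncate (size w) string_lift 0) (lift_signs xpredT w).
Proof. exact: invertedE. Qed.

Lemma nabla_const c : nabla (iotaK c) = iotaS c.
Proof. exact: evaluationC. Qed.

(** Under [nabla] the diagram becomes its expansion and, by induction, the subtracted sum becomes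
    the same expansion without its top state. *)
Lemma nabla_string_lift w : wf_str w -> nabla (string_lift w) = string_value w.
Proof.
have [n] := ubnP (size w); elim: n w => // n IH w; rewrite ltnS => le wf.
have wfl : wf_diag (lift_signs xpredT w) by rewrite wf_lift_signs.
rewrite string_liftE rmorphB /= nabla_kvar //.
rewrite (@closed_sum_morph_wf _ _ iotaK iotaS nabla nabla_const _
  (truncate (size w) string_value 0)) //; last first.
  move=> u wfu _; rewrite /truncate; case: ifP => lt; last exact: rmorph0.
  by apply: IH => //; apply: leq_trans le.
rewrite (closed_sum_top iotaS wfl (g' := truncate (size w) string_value 0)).
  have t0 : truncate (size w) string_value 0 w = 0 by rewrite /truncate ltnn.
  by rewrite lift_signsK t0 subr0 addrAC subrr add0r.
by move=> u; rewrite size_map /truncate => ->.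
Qed.

Lemma nabla_surjective q : exists p, nabla p = q.
Proof.
pose section := evaluation iotaK (fun s : S0 => string_lift (val (repr (val s)))).
exists (section q).
have := @malg_rmorph_ext _ _ _ (nabla \o section) idfun; apply=> [c|s] /=.
  by rewrite /section evaluationC; exact: nabla_const.
rewrite /section evaluationU nabla_string_lift; last exact: (valP (repr (val s))).
rewrite -string_var_val; congr string_var.
by rewrite /str_class valKd reprK.
Qed.

(** * The skein algebra as a quotient ring *)

Definition in_skein_ideal : {pred RK} :=
  fun p => if excluded_middle_informative (skein_ideal p) then true else false.

Lemma in_skein_idealP p : reflect (skein_ideal p) (p \in in_skein_ideal).
Proof.
rewrite unfold_in; case: excluded_middle_informative => h; by constructor.
Qed.

Lemma skein_gen_ideal g : skein_gen g -> skein_ideal g.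
Proof.
move=> gen; exists [:: (1, g)]; split=> [c|]; last by rewrite big_seq1 mul1r.
by rewrite inE => /eqP->.
Qed.

Lemma mul_sum_cat (B : comNzRingType) (a : B) (s t : seq (B * B)) :
  a * (\sum_(c <- s) c.1 * c.2) + \sum_(c <- t) c.1 * c.2 =
  \sum_(c <- [seq (a * c.1, c.2) | c <- s] ++ t) c.1 * c.2.
Proof.
rewrite big_cat big_map mulr_sumr; congr (_ + _).
by apply: eq_bigr => c _; rewrite mulrA.
Qed.

Lemma skein_idealr_closed : idealr_closed in_skein_ideal.
Proof.
split.
- by apply/in_skein_idealP; exists [::]; rewrite big_nil.
(* The ideal is proper because [nabla] kills it but fixes 1. *)
- apply/in_skein_idealP => /nabla_skein_ideal /eqP.
  by rewrite rmorph1 oner_eq0.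
- move=> a p q /in_skein_idealP[s [gens ->]] /in_skein_idealP[t [gent ->]].
  apply/in_skein_idealP; exists ([seq (a * c.1, c.2) | c <- s] ++ t); split.
    by move=> c; rewrite mem_cat => /orP[/mapP[d /gens gd ->] //|/gent].
  exact: mul_sum_cat.
Qed.
HB.instance Definition _ := isIdealr.Build RK in_skein_ideal skein_idealr_closed.

Definition skein_algebra := {ideal_quot in_skein_ideal}.
HB.instance Definition _ := GRing.ComNzRing.on skein_algebra.

Definition skein_class : {rmorphism RK -> skein_algebra} := \pi_skein_algebra.

Lemma skein_class_eq0 p : skein_class p = 0 <-> skein_ideal p.
Proof.
rewrite -(rmorph0 skein_class); split=> [/eqP|ip].
  by rewrite -Quotient.idealrBE subr0 => /in_skein_idealP.
by apply/eqP; rewrite -Quotient.idealrBE subr0; apply/in_skein_idealP.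
Qed.

(** * The inverse homomorphism, for any map with kernel the skein ideal *)

Section SkeinQuotient.

Variables (E : comNzRingType) (skein_class : {rmorphism RK -> E}).
Hypothesis skein_class_eq0 : forall p, skein_class p = 0 <-> skein_ideal p.

Definition iotaE : {rmorphism {poly rat} -> E} := skein_class \o iotaK.

Definition knot_skein (w : seq dendpt) : E := skein_class (kvar (knot_class w)).
Definition string_skein (w : seq sendpt) : E := skein_class (string_lift w).

Lemma skein_combination a b c d : skein_ideal (a - b - z *: (c * d)) ->
  skein_class a - skein_class b = iotaE 'X * (skein_class c * skein_class d).
Proof.
move=> /skein_class_eq0; rewrite -[z *: _]mul_malgC !rmorphB !rmorphM => /eqP.
by rewrite subr_eq0 => /eqP.
Qed.

Lemma knot_skein_skein p b u x y :
  wf_diag (u ++ (p, b, true) :: x ++ (p, ~~ b, true) :: y) ->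
  knot_skein (u ++ (p, b, true) :: x ++ (p, ~~ b, true) :: y) -
  knot_skein (u ++ (p, b, false) :: x ++ (p, ~~ b, false) :: y) =
    iotaE 'X * (knot_skein (dkeep x) * knot_skein (dkeep (y ++ u))).
Proof.
case: b => wf; first rewrite [X in _ * X]mulrC; apply: skein_combination;
  apply: skein_gen_ideal; right.
- by exists u, x, y, p, false.
- by exists u, x, y, p, true.
Qed.

Lemma string_skeinE w : string_skein w = knot_skein (lift_signs xpredT w) -
  closed_sum iotaE (truncate (size w) string_skein 0) (lift_signs xpredT w).
Proof.
apply: etrans (congr1 skein_class (string_liftE w)) _.
apply: etrans (rmorphB _ _ _) _; apply: (f_equal2 (fun a b => a - b)) => //.
apply: closed_sum_morph => // u _; rewrite /truncate; case: ifP => // _; exact: rmorph0.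
Qed.

(** Passing to the quotient is what provides the skein relation and the vanishing of the trivial
    knot; the moves already hold for knot classes. *)
Lemma string_skein_invariant N :
  [/\ expands iotaE knot_skein string_skein N, relabels string_skein N
    & invariant_below string_skein N].
Proof.
apply: (@sigma_invariant _ iotaE knot_skein).
- by apply/skein_class_eq0/skein_gen_ideal; left.
- move=> c w wf; rewrite /knot_skein -cat1s knot_class_rot //.
- by move=> p b s v wf; rewrite /knot_skein knot_class_isolated.
- by move=> p q b s o v t c d x wf; rewrite /knot_skein knot_class_bigon.
- by move=> p q r b v1 v2 v3 al d be w w' /knot_class_triangle [eqk _]; rewrite /knot_skein eqk.
- move=> f w f_inj wf; congr (skein_class (kvar _)); apply/esym/knot_class_step => //.
    by rewrite wf_diag_relabel.
  exact: dstep_relabel.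
- exact: knot_skein_skein.
- exact: string_skeinE.
Qed.

Lemma string_skein_nil : string_skein [::] = 0.
Proof. by have [_ _ /inv_nil] := string_skein_invariant 0. Qed.

Lemma string_skein_class w : wf_str w -> string_skein (val (repr (str_class w))) = string_skein w.
Proof.
apply: str_class_repr => u v; apply: inv_sstep.
  by move=> N; have [] := string_skein_invariant N.
move=> f u' f_inj wf; have [_ rel _] := string_skein_invariant (size u').+1.
exact: rel.
Qed.

Definition psi : {rmorphism RS0 -> E} :=
  evaluation iotaE (fun s : S0 => string_skein (val (repr (val s)))).

Lemma psi_string_value w : wf_str w -> psi (string_value w) = string_skein w.
Proof.
move=> wf; rewrite -string_skein_class // /string_value /string_var.
case: insubP => [s0 _ <-|]; first exact: evaluationU.
rewrite negbK => /eqP ->; rewrite rmorph0 string_skein_class //; exact/esym/string_skein_nil.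
Qed.

Lemma psi_const c : psi (iotaS c) = iotaE c.
Proof. exact: evaluationC. Qed.

Lemma psi_closed_sum w : wf_diag w ->
  psi (closed_sum iotaS string_value w) = closed_sum iotaE string_skein w.
Proof.
move=> wf; have eqg u (wfu : wf_str u) (_ : (size u <= size w)%N) := psi_string_value wfu.
exact: (closed_sum_morph_wf psi_const wf eqg).
Qed.

(** Applied inside the state sum, [psi] turns string values into [string_skein], and the result is
    the expansion of the class of the diagram. *)
Lemma psi_nabla_kvar k : psi (nabla (kvar k)) = skein_class (kvar k).
Proof.
have -> : k = knot_class (val (repr k)) by rewrite /knot_class valKd reprK.
have wf : wf_diag (val (repr k)) := valP (repr k).
move: (val (repr k)) wf => w wf; rewrite (nabla_kvar wf) (psi_closed_sum wf).
have [expN _ _] := string_skein_invariant (size w).+1; exact: expN.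
Qed.

Lemma psi_nabla p : psi (nabla p) = skein_class p.
Proof.
have psi_nabla_const c : psi (nabla (iotaK c)) = skein_class (iotaK c).
  by rewrite nabla_const psi_const.
have ext := @malg_rmorph_ext _ _ _ (psi \o nabla) skein_class psi_nabla_const.
have agree := ext psi_nabla_kvar; exact: agree.
Qed.

Lemma nabla_eq0 p : nabla p = 0 -> skein_ideal p.
Proof. by move=> p0; apply/skein_class_eq0; rewrite -psi_nabla p0 rmorph0. Qed.

End SkeinQuotient.

(** A surjective homomorphism of [R]-algebras with kernel the skein ideal amounts to an isomorphism
    from the quotient by that ideal. *)
Theorem theorem10p1 :
  exists nabla : {lrmorphism RK -> RS0},
    (forall q : RS0, exists p : RK, nabla p = q) /\
    (forall p : RK, nabla p = 0 <-> skein_ideal p).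
Proof.
exists nabla; split; first exact: nabla_surjective.
move=> p; split; last exact: nabla_skein_ideal.
exact: (@nabla_eq0 skein_algebra skein_class skein_class_eq0 p).
Qed.
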